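(* (Graphical Kazhdan–Lusztig basis.) For all $v,w\in W^{\mathfrak p}$ the parabolic Kazhdan–Lusztig polynomial is $$n_{v,w}=\begin{cases}q^{\operatorname{cl}(vC(w))/2}&\text{if } vC(w)\text{ is oriented},\\ 0&\text{otherwise;}\end{cases}$$ equivalently $\underline N_w=\sum_{v\in W^{\mathfrak p},\ vC(w)\text{ oriented}} q^{\operatorname{cl}(vC(w))/2}N_v$.
   Context: Let $n\ge 4$ and let $W$ be the Weyl group of type $D_n$: the Coxeter group on generators $S=\{s_0,\dots,s_{n-1}\}$ with $(s_is_j)^{m_{ij}}=e$, where $m_{ii}=1$, $m_{02}=m_{12}=3$, $m_{i,i+1}=3$ for $2\le i\le n-2$, and $m_{ij}=2$ otherwise. Let $l$ be the length, $S_{\mathfrak p}=\{s_1,\dots,s_{n-1}\}$, $W_{\mathfrak p}=\langle S_{\mathfrak p}\rangle$, and $W^{\mathfrak p}=\{w\in W\mid l(sw)>l(w)\ \forall s\in S_{\mathfrak p}\}$. Sequences: $W$ acts on the right on $\{+,-\}^n$: $s_i$ ($1\le i\le n-1$) swaps entries $i,i+1$; $s_0$ sends $(a_1,a_2,a_3,\dots)$ to $(-a_2,-a_1,a_3,\dots)$. For $w\in W^{\mathfrak p}$ let $(\alpha_1,\dots,\alpha_n)=(+,\dots,+)\cdot w$, $\alpha_{-i}=-\alpha_i$. On $P=\{-2n,\dots,-1,1,\dots,2n\}\subset\mathbb R$ the extended labeling of $w$ puts $+$ at $j<-n$, $-$ at $j>n$, $\alpha_j$ at $1\le|j|\le n$;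 the weight $\lambda(w)$ is this labeling with $+$ replaced by $\downarrow$ and $-$ by $\uparrow$. Cup diagram $C(w)$: take the unique set of $2n$ non-intersecting arcs in the lower half plane matching the points of $P$ in pairs, each arc joining a $+$ point to a $-$ point lying to its right. The arcs joining a negative to a positive point have the form $(-y,y)$; list them $y_1<\dots<y_{2k}$ (their number is even). For each $j$ replace $(-y_{2j-1},y_{2j-1})$, $(-y_{2j},y_{2j})$ by the arcs joining $-y_{2j}$ to $y_{2j-1}$ and $-y_{2j-1}$ to $y_{2j}$ (a linked pair). The resulting arcs are called cups. For $v,w\in W^{\mathfrak p}$, $vC(w)$ is $C(w)$ with the points labeled by $\lambda(v)$. A cup is oriented if one endpoint is labeled $\uparrow$ and the other $\downarrow$ (linked cups are treated as ordinary cups); $vC(w)$ is oriented if all cups are; then $\operatorname{cl}(vC(w))$ is the number of cups whose left endpoint is $\uparrow$ and right endpoint is $\downarrow$. Hecke module: $\mathcal L=\mathbb Z[q,q^{-1}]$; $\mathcal H$ the Hecke algebra of $W$, free over $\mathcal L$ on $H_w$ ($w\in W$) with $H_xH_y=H_{xy}$ if $l(xy)=l(x)+l(y)$ and $H_s^2=(q^{-1}-q)H_s+H_e$; $C_s=H_s+q$. $\mathcal H_{\mathfrak p}$ is the subalgebra spanned by $H_w$, $w\in W_{\mathfrak p}$; $\mathcal L$ is a right $\mathcal H_{\mathfrak p}$-module with $C_s$ acting by $0$ for $s\in S_{\mathfrak p}$. $\mathcal N=\mathcal L\otimes_{\mathcal H_{\mathfrak p}}\mathcal H$ has basis $N_w=1\otimes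 H_w$, $w\in W^{\mathfrak p}$. The involution $H_w\mapsto H_{w^{-1}}^{-1}$, $q\mapsto q^{-1}$ induces an involution of $\mathcal N$; the Kazhdan–Lusztig basis $\underline N_w$ ($w\in W^{\mathfrak p}$) is the unique basis of fixed elements with $\underline N_w\in N_w+\sum_{w'\ne w}q\mathbb Z[q]N_{w'}$, and $n_{w',w}$ is defined by $\underline N_w=\sum_{w'}n_{w',w}N_{w'}$. *)

(* Defs.v *)
From HB Require Import structures.
From mathcomp Require Import all_boot all_order all_algebra fingroup perm.
From mathcomp Require Import fraction.

Set Implicit Arguments.
Unset Strict Implicit.
Unset Printing Implicit Defensive.

Import Order.TTheory GRing.Theory Num.Theory.

Section TypeD.
Variable n : nat.

(* ---------- The Weyl group W of type D_n, realized by signed permutations ----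
   Elements act on the "signed positions" 'I_n * bool  ((j,false) = +e_j,
   (j,true) = -e_j).  Generators are indexed by i : 'I_n (i = 0,...,n-1). *)
Definition gT := {perm ('I_n * bool)}.

Definition gen (i : 'I_n) : gT :=
  let p1 : 'I_n := insubd i (if val i == 0 then 0 else (val i).-1) in
  let p2 : 'I_n := insubd i (if val i == 0 then 1 else val i) in
  if val i == 0 then
    (tperm (p1, false) (p2, true) * tperm (p1, true) (p2, false))%g
  else (tperm (p1, false) (p2, false) * tperm (p1, true) (p2, true))%g.

Definition W : {group gT} := <<[set gen i | i : 'I_n]>>%G.
Definition Wpg : {group gT} := <<[set gen i | i : 'I_n & 0 < val i]>>%G.

Definition word_prod (s : seq 'I_n) : gT := (\prod_(i <- s) gen i)%g.

Definition len (w : gT) : nat :=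
  find (fun k => [exists t : k.-tuple 'I_n, word_prod t == w])
       (iota 0 (#|[set: gT]|.+1)).

Definition rw (w : gT) : seq 'I_n :=
  if [pick t : (len w).-tuple 'I_n | word_prod t == w] is Some t then val t
  else [::].

Definition Wp : {set gT} :=
  [set w in W | [forall i : 'I_n, (0 < val i) ==> (len w < len (gen i * w)%g)]].

Definition F := {fraction {poly int}}.
Definition q : F := tofrac 'X.
Local Open Scope ring_scope.

(* A Laurent polynomial is represented by (p, k), standing for p(q) q^-k. *)
Definition LR := ({poly int} * nat)%type.
Definition valL (r : LR) : F := (map_poly intr r.1).[q] / q ^+ r.2.
Definition barL (r : LR) : F := (map_poly intr r.1).[q^-1] * q ^+ r.2.
Definition in_qZq (x : F) : Prop :=
  exists p : {poly int}, p`_0 = 0 /\ x = (map_poly intr p).[q].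

(* ---------- The module N: elements are coefficient vectors sum_w a_w N_w,
   represented as functions gT -> F, only entries in W^p being relevant. *)
Definition vecN := {ffun gT -> F}.
Definition Nb (w : gT) : vecN := [ffun x => (x == w)%:R].

(* pi(H_x) = 1 (x) H_x = 1 (x) H_y H_m = (-q)^{l(y)} N_m, x = y m,
   y in W_p, m in W^p *)
Definition piv (x : gT) : vecN :=
  [ffun m => if (m \in Wp) && ((x * m^-1)%g \in Wpg)
             then (- q) ^+ len (x * m^-1)%g else 0].

(* right action of H_s on N:  N_w H_s = pi(H_w H_s) *)
Definition actS (s : 'I_n) (m : vecN) : vecN :=
  [ffun y => \sum_(w in Wp) m w *
      (piv (w * gen s)%g y +
       (if (len (w * gen s)%g < len w)%N then (q^-1 - q) * piv w y else 0))].

Definition actSinv (s : 'I_n) (m : vecN) : vecN :=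
  [ffun y => actS s m y + (q - q^-1) * m y].

(* bar(N_w) = 1 (x) H_{w^-1}^{-1} = N_e H_{s1}^-1 ... H_{sk}^-1
   for a reduced expression w = s1 ... sk *)
Definition barNb (w : gT) : vecN :=
  foldl (fun m s => actSinv s m) (Nb 1%g) (rw w).

Definition barN (r : gT -> LR) : vecN :=
  [ffun y => \sum_(w in Wp) barL (r w) * barNb w y].

(* b w v = coefficient of N_v in the candidate \underline N_w.
   KLfam b : b is the Kazhdan-Lusztig basis (bar invariant and
   \underline N_w in N_w + sum_{w' <> w} q Z[q] N_{w'}). *)
Definition KLfam (b : gT -> gT -> LR) : Prop :=
  forall w, w \in Wp ->
    [/\ forall v, v \in Wp -> barN (b w) v = valL (b w v),
        valL (b w w) = 1 &
        forall v, v \in Wp -> v != w -> in_qZq (valL (b w v))].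

Local Close Scope ring_scope.
(* alpha = (+,...,+) . w  (true = '+'); (a.w)_j = +-a_k where w^-1(j,+) = (k,+-) *)
Definition alpha (w : gT) (k : nat) : bool :=
  if insub k is Some j then ~~ ((w^-1)%g (j, false)).2 else true.

(* The 4n points of P = {-2n..-1,1..2n}, in increasing order, are 'I_(4n):
   p < 2n  is the point p - 2n,   p >= 2n  is the point p - 2n + 1. *)
Definition pt := 'I_(4 * n).
Definition isneg (p : pt) : bool := val p < 2 * n.
Definition mirror (p : pt) : pt := rev_ord p.

(* extended labeling (true = '+' = down, false = '-' = up) *)
Definition lab (w : gT) (p : pt) : bool :=
  if val p < n then true                       (* point < -n *)
  else if val p < 2 * n then ~~ alpha w (2 * n - val p).-1 (* -n..-1 *)
  else if val p < 3 * n then alpha w (val p - 2 * n)       (* 1..n *)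
  else false.                                  (* point > n *)

Definition isCupMatching (w : gT) (f : {ffun pt -> pt}) : bool :=
  [forall x : pt, (f x != x) && (f (f x) == x)] &&
  [forall x : pt, (x < f x) ==> (lab w x && ~~ lab w (f x))] &&
  [forall x : pt, forall y : pt, ~~ [&& x < y, y < f x & f x < f y]].

Definition arcs0 (w : gT) : {set pt * pt} :=
  if [pick f | isCupMatching w f] is Some f then
    [set xy | (xy.2 == f xy.1) && (xy.1 < xy.2)]
  else set0.

Definition crossing (xy : pt * pt) : bool := isneg xy.1 && ~~ isneg xy.2.

(* the positive endpoints y_1 < ... < y_2k of the arcs (-y, y) *)
Definition Ys (w : gT) : seq pt :=
  [seq y <- enum pt | [exists x : pt, ((x, y) \in arcs0 w) && crossing (x, y)]].

(* partner index: y_{2j-1} <-> y_{2j} *)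
Definition partner (i : nat) : nat := if odd i then i.-1 else i.+1.

(* the cups of C(w): arcs (-y_{2j}, y_{2j-1}), (-y_{2j-1}, y_{2j}) replace
   (-y_{2j-1}, y_{2j-1}), (-y_{2j}, y_{2j}) *)
Definition cups (w : gT) : {set pt * pt} :=
  [set xy in arcs0 w | ~~ crossing xy] :|:
  [set (mirror (nth y (Ys w) (partner (index y (Ys w)))), y) | y in Ys w].

Definition oriented (v w : gT) : bool :=
  [forall xy in cups w, lab v xy.1 != lab v xy.2].
Definition cl (v w : gT) : nat :=
  #|[set xy in cups w | ~~ lab v xy.1 && lab v xy.2]|.

End TypeD.

(* Main.v *)
(* For each w let G_w be the vector given by the oriented labelings of the cup diagram of w. The G_w are unitriangular over the standard basis, with off-diagonal entries in q Z[q]. On sign sequences C_s acts as a cap followed by a cup at two neighbouring positions, so G_w C_s is (q + q^-1) G_w, 0 or some G_w'. Hence the semilinear map fixing all the G_w commutes with the right action in the sense m H_s |-> bar(m) H_s^-1, and as it fixes N_e = G_e it maps N_w to N_e H_(s_1)^-1 ... H_(s_k)^-1 for a reduced word of w: it is the bar involution, which therefore fixes every G_w. No braid relation is needed. Conversely, a bar-invariant element of N_w + sum q Z[q] N_v is a combination of the G_v with bar-invariant coefficients which triangularity forces to be those of G_w.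

Cup diagrams are handled by reading the sign sequence with a stack of open cups, which makes the straightening of G_w C_s a short case analysis. *)

(* Three translations prepare this argument. The symmetry [j |-> -j] makes undotted cups clockwise
   together with their mirror images, and orientation makes the two cups of a linked pair clockwise
   together. So the positive half of a diagram carries all the information, and halving [cl] counts
   each of its cups once. There the points beyond [n] have a fixed label, which leaves [n] letters
   to read.

   Straightening produces a bare sign sequence, which has to come from an element of [W^p]. The
   sequences that do are those with an even number of minus signs, so parity is carried through the
   straightening.

   Length is given as a search over words, and [W^p] is given by length. Both are re-expressed by
   inversions of signed permutations, from which follow the bijection between [W^p] and even
   sequences and the effect of right multiplication by a generator. The bar map is given on
   representatives [(p, k)], not on the field, and is therefore treated as a relation that is then
   shown to be single-valued. *)
Require Import Defs.
From HB Require Import structures.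
From mathcomp Require Import all_boot all_order all_algebra fingroup perm.
From mathcomp Require Import fraction.
From mathcomp Require Import ring zify.

Set Implicit Arguments.
Unset Strict Implicit.
Unset Printing Implicit Defensive.

Import Order.TTheory GRing.Theory Num.Theory.

(** * A stack machine for cup diagrams *)

Section Machine.
Local Open Scope ring_scope.
Variables (K : fieldType) (q : K).
Hypothesis q0 : q != 0.

(* Reads the letters of [w] ([true] = [+]) from left to right with a stack of open cups, and evaluates the cup diagram of [w] at the labels [v]. A stack entry is the label that the right end closing that cup must carry: [~~ x] if a [+] labeled [x] opens an undotted cup, [x] if a [-] labeled [x] opens a dotted one (a linked pair). A cup is clockwise, and contributes [q], exactly when its right end is labeled [true]. *)
Fixpoint exec (k : seq bool -> K) (S w v : seq bool) : K :=
  match w, v with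
  | c :: w', x :: v' =>
      if c then exec k (~~ x :: S) w' v' else
      match S with
      | [::] => exec k [:: x] w' v'
      | e :: S' => if x == e then q ^+ x * exec k S' w' v' else 0
      end
  | _, _ => k S
  end.

(* The cups left open are closed by points beyond [n], all labeled [false]. *)
Definition closing (S : seq bool) : K := (~~ has id S)%:R.
Notation run := (exec closing).

Lemma eq_exec k1 k2 S w v : k1 =1 k2 -> exec k1 S w v = exec k2 S w v.
Proof.
move=> e; elim: w S v => [|c w IH] S [|x v] //=.
by case: c => //; case: S => [|f S] //; rewrite IH.
Qed.

Lemma exec_cat k S p r u t : size p = size u ->
  exec k S (p ++ r) (u ++ t) = exec (fun S' => exec k S' r t) S p u.
Proof.
elim: p S u => [|c p IH] S [|x u] //= [su].
by case: c; [exact: IH | case: S => [|f S]; rewrite IH].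
Qed.

Lemma exec_lin k1 k2 a S w v :
  exec (fun S => k1 S + a * k2 S) S w v = exec k1 S w v + a * exec k2 S w v.
Proof.
elim: w S v => [|c w IH] S [|x v] //=.
case: c; first exact: IH.
case: S => [|f S]; first exact: IH.
by rewrite IH; case: ifP => _; ring.
Qed.

Lemma exec0 S w v : exec (fun=> 0) S w v = 0.
Proof.
elim: w S v => [|c w IH] S [|x v] //=.
by case: c => //; case: S => [|f S] //; rewrite IH mulr0 if_same.
Qed.

Lemma exec_scale k a S w v :
  exec (fun S => a * k S) S w v = a * exec k S w v.
Proof.
rewrite -[RHS]add0r -(exec0 S w v) -exec_lin.
by apply: eq_exec => S'; rewrite add0r.
Qed.

(* [height h w]: the stack height after reading [w] from height [h]; it does not depend on the labels. *)
Fixpoint height (h : nat) (w : seq bool) : nat :=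
  match w with
  | [::] => h
  | c :: w' => height (if c then h.+1 else if h is h'.+1 then h' else 1) w'
  end.

Lemma height_rcons h w c : height h (rcons w c) =
  if c then (height h w).+1 else if height h w is h'.+1 then h' else 1.
Proof. by elim: w h => [|d w IH] h //=. Qed.

Lemma eq_exec_height k1 k2 S w v : size v = size w ->
  (forall S', size S' = height (size S) w -> k1 S' = k2 S') ->
  exec k1 S w v = exec k2 S w v.
Proof.
elim: w S v => [|c w IH] S [|x v] //= => [_ e|[sv] e]; first exact: e.
case: c e => e; first exact: IH.
by case: S e => [|f S] e; [exact: IH | rewrite (IH S)].
Qed.

Lemma exec_rcons k S w c v x : size v = size w ->
  exec k S (rcons w c) (rcons v x) = exec (fun S' => exec k S' [:: c] [:: x]) S w v.
Proof. by move=> sv; rewrite -!cats1 exec_cat. Qed.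

Definition par (w : seq bool) : bool := odd (count negb w).

Lemma par_cons c w : par (c :: w) = ~~ c (+) par w.
Proof. by rewrite /par /= oddD oddb. Qed.

Lemma par_cat p w : par (p ++ w) = par p (+) par w.
Proof. by rewrite /par count_cat oddD. Qed.

Lemma par_rcons p c : par (rcons p c) = ~~ c (+) par p.
Proof. by rewrite -cats1 par_cat par_cons addbF addbC. Qed.

(** If no letter reaches the two bottom entries, [closing] keeps the first term only. Otherwise the
    [-] labeled [x] that reaches them selects the term with entries [x], its weight cancels [q^-1]
    when [x] is [true], and the entry [x] left behind is the one a dotted cup would have pushed on
    the empty stack. *)
Lemma run_double_bottom T r t : size t = size r ->
  run (T ++ [:: false; false]) r t + q^-1 * run (T ++ [:: true; true]) r t
  = run T r t.
Proof.
elim: r T t => [|c r IH] T [|x t] //= => [_|[st]].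
  by rewrite /closing !has_cat /= !orbF orbT mulr0 addr0.
case: c; first exact: (IH (~~ x :: T)).
case: T => [|e T] /=.
  by case: x; rewrite /= ?expr0 ?expr1 ?mulr0 ?mul1r ?addr0 ?add0r ?mulKf.
case: ifP => _; last by rewrite mulr0 addr0.
by rewrite -(IH T) // mulrDr mulrCA.
Qed.

(* The first letter of [r] popping below height [h] is turned into a [+]; if there is none, the sum vanishes. *)
Lemma run_join_above r h :
  (forall T S t, size T = h -> size t = size r ->
    run (T ++ [:: false, true & S]) r t + q^-1 * run (T ++ [:: true, false & S]) r t = 0)
  \/ exists r', [/\ size r' = size r, par r' = ~~ par r &
    forall T S t, size T = h -> size t = size r ->
    run (T ++ [:: false, true & S]) r t + q^-1 * run (T ++ [:: true, false & S]) r t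
    = run (T ++ S) r' t].
Proof.
elim: r h => [|c r IH] h.
  (* Each of the two stacks still contains a [true], so [closing] kills both terms. *)
  left=> T S [|//] _ _ /=.
  by rewrite /closing !has_cat /= !orbT /= mulr0 addr0.
have [->|nc] : c = true \/ c = false by case: c; [left|right].
  have [Z|[r' [sr pr Hr]]] := IH h.+1.
    left=> T S [|x t] //= sT [st]; rewrite (Z (~~ x :: T)) //=; by rewrite sT.
  right; exists (true :: r'); split=> [||T S [|x t] //= sT [st]].
  - by rewrite /= sr.
  - by rewrite !par_cons pr.
  - by rewrite (Hr (~~ x :: T)) //= sT.
rewrite nc; case: h => [|h].
  (* A [-] labeled [x] selects the term whose first entry is [x] and leaves [~~ x], which is what a
     [+] labeled [x] pushes. *)
  right; exists (true :: r); split=> [//||[|//] S [|x t] //= _ [st]].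
    by rewrite !par_cons; case: (par r).
  by case: x; rewrite /= ?expr0 ?expr1 ?mulr0 ?mul1r ?addr0 ?add0r ?mulKf.
have [Z|[r' [sr pr Hr]]] := IH h.
  left=> [[//|e T]] S [|x t] //= [sT] [st]; case: ifP => _.
    by rewrite mulrCA -mulrDr Z // mulr0.
  by rewrite mulr0 addr0.
right; exists (false :: r'); split=> [||[//|e T] S [|x t] //= [sT] [st]].
- by rewrite /= sr.
- by rewrite !par_cons pr.
- case: ifP => _; last by rewrite mulr0 addr0.
  by rewrite mulrCA -mulrDr Hr.
Qed.

Fixpoint flip_last (S : seq bool) : seq bool :=
  match S with
  | [::] => [::]
  | [:: e] => [:: ~~ e]
  | e :: S' => e :: flip_last S'
  end.

(** The bottom entry was pushed when the stack was last empty: by a [+] labeled [x] as [~~ x], or by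
    a [-] as [x]. Exchanging these two letters there negates the entry and changes nothing else. In
    the picture, a dot slides along its arc. *)
Lemma exec_flip_last p : (0 < height 0 p)%N ->
  exists p', [/\ size p' = size p, par p' = ~~ par p &
  forall k u, size u = size p ->
    exec (k \o flip_last) [::] p u = exec k [::] p' u].
Proof.
elim/last_ind: p => [//|p c IH]; rewrite height_rcons.
case: (posnP (height 0 p)) => [h0|h0] hc.
  exists (rcons p (~~ c)); split=> [||k u]; first by rewrite !size_rcons.
    by rewrite !par_rcons; case: c {hc}; case: (par p).
  case/lastP: u => [|u x]; rewrite !size_rcons => [[]] // su.
  rewrite !exec_rcons //; apply: eq_exec_height => // S.
  by rewrite h0; case: S => // _; case: (c) => /=; rewrite ?negbK.
have {IH}[p' [sp pp Hp]] := IH h0.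
exists (rcons p' c); split=> [||k u]; first by rewrite !size_rcons sp.
  by rewrite !par_rcons pp addbN.
case/lastP: u => [|u x]; rewrite !size_rcons => [[]] // su.
rewrite !exec_rcons ?sp // -Hp //; apply: eq_exec_height => // S sS.
case: S sS hc => [|e [|f S]] /= sS; first by rewrite -sS in h0.
  by rewrite -sS; case: (c).
by case: (c).
Qed.

(* The continuation [k] precomposed with the removal of the entries [e], [f] at depth [d], weighted as if the letter that pushed [e] had popped [f]. *)
Definition pop_below (d : nat) (k : seq bool -> K) (S : seq bool) : K :=
  if drop d S is [:: e, f & S'] then
    if f == ~~ e then q ^+ f * k (take d S ++ S') else 0
  else 0.

(** An entry with another one beneath it was pushed by a [+]. Turning that [+] into a [-] makes it
    pop the entry beneath. The letter is found by walking back from the end of [p]: a [-] increases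
    the depth [d], a [+] decreases it, and a [+] met at depth 0 is the one. *)
Lemma exec_pop_below p d : (d.+2 <= height 0 p)%N ->
  exists p', [/\ size p' = size p, par p' = ~~ par p &
  forall k u, size u = size p ->
    exec (pop_below d k) [::] p u = exec k [::] p' u].
Proof.
elim/last_ind: p d => [//|p c IH] d; rewrite height_rcons.
case: c => [|]; last first.
  case hp: (height 0 p) => [|h] // hd.
  have [|p' [sp pp Hp]] := IH d.+1; first by rewrite hp.
  exists (rcons p' false); split=> [||k u]; first by rewrite !size_rcons sp.
    by rewrite !par_rcons pp addbN.
  case/lastP: u => [|u x]; rewrite !size_rcons => [[]] // su.
  rewrite !exec_rcons ?sp // -Hp //; apply: eq_exec_height => // S.
  rewrite hp; case: S => [//|g S] /= _; rewrite /pop_below /=.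
  case: (drop d S) => [|e [|f S']]; rewrite ?mulr0 ?if_same //.
  by case: ifP => _; case: ifP => _; rewrite ?mulr0 // mulrCA.
case: d => [|d] hd.
  exists (rcons p false); split=> [||k u]; first by rewrite !size_rcons.
    by rewrite !par_rcons addTb.
  case/lastP: u => [|u x]; rewrite !size_rcons => [[]] // su.
  rewrite !exec_rcons //; apply: eq_exec_height => // S sS.
  case: S sS hd => [|f S] /= sS; first by rewrite -sS.
  by rewrite /pop_below /= negbK eq_sym; case: eqP => // ->.
have [|p' [sp pp Hp]] := IH d; first by rewrite -ltnS.
exists (rcons p' true); split=> [||k u]; first by rewrite !size_rcons sp.
  by rewrite !par_rcons pp.
case/lastP: u => [|u x]; rewrite !size_rcons => [[]] // su.
by rewrite !exec_rcons ?sp // -Hp.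
Qed.

(* The cups created by [C_s], for [s <> s_0] and for [s = s_0]. *)
Definition cup (a b : bool) : K := if b == ~~ a then q ^+ b else 0.
Definition cup0 (a b : bool) : K := if b == a then q ^+ b else 0.

Lemma run_cup p r u t a b S : size p = size u ->
  run S (p ++ [:: true, false & r]) (u ++ [:: a, b & t])
  = cup a b * exec (fun S => run S r t) S p u.
Proof.
move=> sp; rewrite exec_cat //= /cup; case: ifP => _; last first.
  by rewrite exec0 mul0r.
by rewrite exec_scale.
Qed.

Lemma run_cup0 r t a b :
  run [::] [:: false, false & r] [:: a, b & t] = cup0 a b * run [::] r t.
Proof. by rewrite /= /cup0; case: ifP => _; rewrite ?mul0r. Qed.

(* [C_s] acts on a diagram by capping off two neighbours and adding a cup there: this closes a loop, gives zero, or yields another diagram. *)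
Inductive TL_result (w : seq bool) : Type :=
| TL_loop | TL_zero | TL_diagram w' of size w' = size w & par w' = par w.

Definition TL_value w (o : TL_result w) (v : seq bool) : K :=
  match o with
  | TL_loop => (q + q^-1) * run [::] w v
  | TL_zero => 0
  | TL_diagram w' _ _ => run [::] w' v
  end.

(** The sum in parentheses is the cap, with weight 1 on labels [false, true] and [q^-1] on
    [true, false]; the factor [cup] is the new cup. *)
Lemma run_TL p c d r : exists o : TL_result (p ++ [:: c, d & r]),
  forall u a b t, size u = size p -> size t = size r ->
    cup a b * (run [::] (p ++ [:: c, d & r]) (u ++ [:: false, true & t])
       + q^-1 * run [::] (p ++ [:: c, d & r]) (u ++ [:: true, false & t]))
    = TL_value o (u ++ [:: a, b & t]).
Proof.
pose J c d r t S := exec closing S [:: c, d & r] [:: false, true & t]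
  + q^-1 * exec closing S [:: c, d & r] [:: true, false & t].
have JE c' d' u t : size u = size p ->
    run [::] (p ++ [:: c', d' & r]) (u ++ [:: false, true & t])
     + q^-1 * run [::] (p ++ [:: c', d' & r]) (u ++ [:: true, false & t])
   = exec (J c' d' r t) [::] p u.
  by move=> su; rewrite !exec_cat // -exec_lin.
(* Enough to straighten what surrounds the cap into [p'] and [r']. The inserted letters [+ -]
   contribute one minus sign, hence the negation in the parity condition. *)
have key p' r' : size p' = size p -> size r' = size r ->
    par p' (+) par r' = ~~ (par p (+) par r (+) c (+) d) ->
    (forall u t, size u = size p -> size t = size r ->
      exec (J c d r t) [::] p u = exec (fun S => run S r' t) [::] p' u) ->
    exists o : TL_result (p ++ [:: c, d & r]),
  forall u a b t, size u = size p -> size t = size r ->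
    cup a b * (run [::] (p ++ [:: c, d & r]) (u ++ [:: false, true & t])
       + q^-1 * run [::] (p ++ [:: c, d & r]) (u ++ [:: true, false & t]))
    = TL_value o (u ++ [:: a, b & t]).
  move=> sp sr pp H.
  have sw : size (p' ++ [:: true, false & r']) = size (p ++ [:: c, d & r]).
    by rewrite !size_cat /= sp sr.
  have pw : par (p' ++ [:: true, false & r']) = par (p ++ [:: c, d & r]).
    rewrite !par_cat !par_cons /=; move: pp.
    by case: (par p'); case: (par r'); case: (par p); case: (par r); case: (c); case: (d).
  exists (TL_diagram sw pw) => u a b t su st /=.
  by rewrite JE // H // run_cup // sp su.
have inv1 : q * q^-1 = 1 by rewrite divff.
have inv2 : q^-1 * q = 1 by rewrite mulVf.
case: c key; case: d => key.
(* Letters [+ +]: two left ends are joined, and the right end of the inner cup becomes the left end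
   of the outer one. *)
- have [Z|[r' [sr pr Hr]]] := run_join_above r 0.
    exists (TL_zero _) => u a b t su st /=; rewrite JE //.
    rewrite (_ : exec _ _ _ _ = 0) ?mulr0 // -(exec0 [::] p u).
    by apply: eq_exec => S; rewrite /J /=; apply: (Z [::] S t).
  apply: (key p r') => // [|u t su st].
    by rewrite pr; case: (par p); case: (par r).
  by apply: eq_exec => S; rewrite /J /=; apply: (Hr [::] S t).
(* Letters [+ -]: the cap closes a loop, whose two labelings weigh [q] and [q^-1]. *)
- exists (TL_loop _) => u a b t su st /=; rewrite JE // run_cup ?su //.
  rewrite mulrCA; congr (_ * _).
  rewrite -exec_scale; apply: eq_exec => S; rewrite /J /=; ring.
(* Letters [- +]: on a nonempty stack the cap passes the top entry on unchanged; on the empty one a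
   dotted cup is joined to the next cup. *)
- have [z|nz] := posnP (height 0 p).
    apply: (key p r) => // [|u t su st].
      by case: (par p); case: (par r).
    apply: eq_exec_height => // S; rewrite z; case: S => // _.
    by rewrite /J /=; apply: (run_double_bottom [::]).
  apply: (key p r) => // [|u t su st].
    by case: (par p); case: (par r).
  apply: eq_exec_height => // S sS; case: S sS nz => [<- //|e S] _ _.
  by rewrite /J /=; case: e; rewrite /= ?expr0 ?expr1 ?mulr0 ?mul1r ?addr0 ?add0r ?mulKf.
(* Letters [- -]. Height 0: they form a dotted cup, which wants equal labels where the cap wants
   opposite ones. Height 1: the only open cup is continued by a dotted one, which negates its entry.
   Height at least 2: two open cups are joined. *)
case hp: (height 0 p) => [|[|h]].
- exists (TL_zero _) => u a b t su st /=; rewrite JE //.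
  rewrite (_ : exec _ _ _ _ = 0) ?mulr0 // -(exec0 [::] p u).
  apply: eq_exec_height => // S; rewrite hp; case: S => // _.
  by rewrite /J /= mulr0 addr0.
- have [|p' [sp pp Hp]] := @exec_flip_last p; first by rewrite hp.
  apply: (key p' r) => // [|u t su st].
    by rewrite pp; case: (par p); case: (par r).
  rewrite -Hp //; apply: eq_exec_height => // S; rewrite hp.
  case: S => [|e [|//]] // _.
  by rewrite /J /=; case: e; rewrite /= ?expr0 ?expr1 ?mulr0 ?mul1r ?addr0 ?add0r ?mulKf.
have [|p' [sp pp Hp]] := @exec_pop_below p 0; first by rewrite hp.
apply: (key p' r) => // [|u t su st].
  by rewrite pp; case: (par p); case: (par r).
rewrite -Hp //; apply: eq_exec_height => // S; rewrite hp.
case: S => [|e [|f S]] // _.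
by rewrite /J /pop_below /=; case: e; case: f; rewrite /= ?expr0 ?expr1 ?mulr0 ?mul1r ?addr0 ?add0r ?mulKf.
Qed.

(** Now the cap wants equal labels and sits at the start, where the stack is empty. So [- -] gives
    the loop and [+ -], an undotted cup, gives zero. *)
Lemma run_TL0 c d r : exists o : TL_result [:: c, d & r],
  forall a b t, size t = size r ->
    cup0 a b * (run [::] [:: c, d & r] [:: true, true & t]
       + q^-1 * run [::] [:: c, d & r] [:: false, false & t])
    = TL_value o [:: a, b & t].
Proof.
have key r' : size r' = size r -> par r' = par r (+) c (+) d ->
    (forall t, size t = size r ->
      run [::] [:: c, d & r] [:: true, true & t]
       + q^-1 * run [::] [:: c, d & r] [:: false, false & t] = run [::] r' t) ->
    exists o : TL_result [:: c, d & r],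
  forall a b t, size t = size r ->
    cup0 a b * (run [::] [:: c, d & r] [:: true, true & t]
       + q^-1 * run [::] [:: c, d & r] [:: false, false & t])
    = TL_value o [:: a, b & t].
  move=> sr pr H.
  have sw : size [:: false, false & r'] = size [:: c, d & r] by rewrite /= sr.
  have pw : par [:: false, false & r'] = par [:: c, d & r].
    by rewrite !par_cons pr; case: (c); case: (d); case: (par r).
  exists (TL_diagram sw pw) => a b t st; rewrite H //.
  by rewrite -run_cup0.
case: c key; case: d => key.
- apply: (key r) => [//||t st]; first by case: (par r).
  exact: (run_double_bottom [::]).
- by exists (TL_zero _) => a b t st /=; rewrite mulr0 addr0 mulr0.
- have [Z|[r' [sr pr Hr]]] := run_join_above r 0.
    exists (TL_zero _) => a b t st.
    by rewrite [X in _ * X](Z [::] [::] t) ?mulr0.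
  apply: (key r') => // [|t st]; first by rewrite pr; case: (par r).
  exact: (Hr [::] [::] t).
exists (TL_loop _) => a b t st; rewrite /TL_value !run_cup0 /cup0 /=.
ring.
Qed.

(** * Triangularity and powers of [q] *)

Lemma run_diag w S : run S w w = (~~ has id S)%:R.
Proof.
elim: w S => [//|[] w IH] [|e S] //=; rewrite IH //=.
by case: e; rewrite //= expr0 mul1r.
Qed.

(** A binary number with digit 1 for [-] and the first letter least significant, so the last place
    where two sequences differ decides their order. *)
Fixpoint lexval (w : seq bool) : nat :=
  if w is c :: w' then (2 * lexval w' + ~~ c)%N else 0.

(** When the value is nonzero, [v] differs from [w] by flipped cups. The last difference is the
    right end of such a cup, as [closing] forbids flipping cups left open; there [w] has [-] and [v]
    has [+]. *)
Lemma run_lexval S w v : size v = size w -> run S w v != 0 ->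
  v = w \/ (lexval v < lexval w)%N.
Proof.
elim: w S v => [|c w IH] S [|x v] //= => [_ _|[sv]]; first by left.
case: c.
- move=> /[dup] nz /(IH _ _ sv) [] vw.
    move: nz; rewrite vw run_diag /=.
    by case: x => /=; [left | rewrite eqxx].
  by right; move: vw; case: x {nz}; lia.
have rec T : run T w v != 0 -> x :: v = false :: w \/
    (2 * lexval v + ~~ x < 2 * lexval w + ~~ false)%N.
  move=> /(IH _ _ sv) []; last by right; case: x; lia.
  by move=> ->; case: x => /=; [right; lia | left].
case: S => [|e S]; first exact: rec.
by case: ifP => _; [rewrite mulf_eq0 negb_or => /andP[_] /rec | rewrite eqxx].
Qed.

(* Exponent 0 means that every popped entry is false, so that no cup is flipped. *)
Lemma run_power S w v : size v = size w -> run S w v = 0 \/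
  exists k, run S w v = q ^+ k /\ (k = 0%N -> ~~ has id S /\ v = w).
Proof.
elim: w S v => [|c w IH] S [|x v] //= => [_|[sv]].
  rewrite /closing; case: has; [by left | right; exists 0%N].
  by rewrite expr0.
have keep T : (~~ has id T -> x = c /\ ~~ has id S) -> run T w v = 0 \/ exists k,
    run T w v = q ^+ k /\ (k = 0%N -> ~~ has id S /\ x :: v = c :: w).
  move=> H; have [|[k [-> Hk]]] := IH T v sv; [by left|right; exists k].
  by split=> // /Hk[/H[-> ->] ->].
case: c keep => keep.
  by apply: keep => /=; rewrite negb_or negbK => /andP[].
case: S keep => [|e S] keep; first by apply: keep => /=; case: x.
case: eqP => [xe|]; last by left.
have [->|[k [-> Hk]]] := IH S v sv; first by left; rewrite mulr0.
right; exists (x + k)%N; split; first by rewrite exprD.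
by rewrite -xe; case: (x) => //= /Hk[-> ->].
Qed.

End Machine.

(** * Non-crossing matchings and heights *)

Section Heights.
Variable l : nat -> bool.

Fixpoint ht (k : nat) : int :=
  if k is j.+1 then (ht j + (if l j then 1 else -1))%R else 0%R.

Lemma htS k : ht k.+1 = (ht k + (if l k then 1 else -1))%R. Proof. by []. Qed.

(** [ht k] is the height before letter [k], so [ht y.+1] is the height after letter [y]. The arc
    ends where the path first returns to the level from which [x] left. *)
Definition arc (x y : nat) : bool :=
  [&& x < y, ht y.+1 == ht x & all (fun z => ht x < ht z)%R (iota x.+1 (y - x))].

Lemma arcP x y : reflect
  [/\ x < y, ht y.+1 = ht x & forall z, x < z -> z <= y -> (ht x < ht z)%R]
  (arc x y).
Proof.
apply: (iffP and3P) => [[xy /eqP e /allP a]|[xy e a]]; split=> //.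
- by move=> z xz zy; apply: a; rewrite mem_iota; lia.
- by apply/eqP.
- by apply/allP => z; rewrite mem_iota => zz; apply: a; lia.
Qed.

Lemma arc_l x y : arc x y -> l x /\ l y = false.
Proof.
case/arcP => xy e a; have := a x.+1; have := a y; move: e; rewrite !htS.
by case: (l x); case: (l y); lia.
Qed.

Lemma arc_uniqr x y y' : arc x y -> arc x y' -> y = y'.
Proof.
case/arcP => xy e a /arcP[xy' e' a'].
by case: (ltngtP y y') => // H; [have := a' y.+1 | have := a y'.+1]; lia.
Qed.

Lemma arc_uniql x x' y : arc x y -> arc x' y -> x = x'.
Proof.
case/arcP => xy e a /arcP[xy' e' a'].
by case: (ltngtP x x') => // H; [have := a x' | have := a' x]; lia.
Qed.

Lemma arc_nocross x y x' y' : arc x x' -> arc y y' ->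
  ~~ [&& x < y, y < x' & x' < y'].
Proof.
move=> /arcP[xy e a] /arcP[xy' e' a']; apply/negP => /and3P[h1 h2 h3].
have := a y; have := a' x'.+1; lia.
Qed.

Variable N : nat.
Hypothesis ht_ge0 : forall k, k <= N -> (0 <= ht k)%R.
Hypothesis htN : ht N = 0%R.

Lemma arc_from x : x < N -> l x -> exists2 y, y < N & arc x y.
Proof.
move=> xN lx.
have ex : exists k, (x < k) && (ht k <= ht x)%R.
  by exists N; rewrite xN htN; exact: ht_ge0 (ltnW xN).
have kN : ex_minn ex <= N.
  by case: ex_minnP => k _; apply; rewrite xN htN; exact: ht_ge0 (ltnW xN).
case: ex_minnP kN => k /andP[xk hk] mk kN.
have mk' z : x < z -> z < k -> (ht x < ht z)%R.
  by move=> xz zk; rewrite ltNge; apply/negP => zx; have := mk z; rewrite xz zx; lia.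
have xk1 : x.+1 < k.
  by rewrite ltn_neqAle xk andbT; apply/eqP => e; move: hk; rewrite -e htS lx; lia.
case: k xk hk mk kN mk' xk1 => // k xk hk mk kN mk' xk1.
exists k => //; apply/arcP; split=> [//||z xz zk]; last exact: mk'.
by have := mk' k; move: hk; rewrite htS; case: (l k); lia.
Qed.

Lemma arc_to y : y < N -> l y = false -> exists2 x, x < N & arc x y.
Proof.
move=> yN ly.
have ex : exists k, (k <= y) && (ht k <= ht y.+1)%R.
  by exists 0; exact: ht_ge0.
have bd k : (k <= y) && (ht k <= ht y.+1)%R -> k <= y by case/andP.
case: (ex_maxnP ex bd) => x /andP[xy hx] mx.
have mx' z : x < z -> z <= y -> (ht y.+1 < ht z)%R.
  by move=> xz zy; rewrite ltNge; apply/negP => h; have := mx z; rewrite zy h; lia.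
have xy1 : x < y.
  rewrite ltn_neqAle xy andbT; apply/eqP => e; move: hx.
  by rewrite e htS ly; lia.
have hE : ht y.+1 = ht x.
  by have := mx' x.+1; move: hx; rewrite [ht x.+1]htS; case: (l x); lia.
exists x; first lia.
by apply/arcP; split=> // z xz zy; rewrite -hE; exact: mx'.
Qed.

Definition matching (f : 'I_N -> 'I_N) : Prop :=
  [/\ forall x : 'I_N, f x != x /\ f (f x) = x,
      forall x : 'I_N, x < f x -> l x /\ l (f x) = false &
      forall x y : 'I_N, ~~ [&& x < y, y < f x & f x < f y]].

Lemma matching_exists : exists f : {ffun 'I_N -> 'I_N},
  matching f /\ forall x : 'I_N, l x -> arc x (f x).
Proof.
pose f := [ffun x : 'I_N => odflt x [pick y : 'I_N | arc x y || arc y x]].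
have fP (x : 'I_N) : arc x (f x) || arc (f x) x.
  rewrite ffunE; case: pickP => [y //|no].
  case lx: (l x).
    have [y yN a] := arc_from (ltn_ord x) lx.
    by have := no (Ordinal yN); rewrite /= a.
  have [y yN a] := arc_to (ltn_ord x) lx.
  by have := no (Ordinal yN); rewrite /= a orbT.
have lt_arc x y : arc x y -> x < y by case/arcP.
exists f; split=> [|x lx]; last first.
  by case/orP: (fP x) => // /arc_l[_]; rewrite lx.
split=> [x|x xf|x y].
- split; first by apply/eqP => e; have := fP x; rewrite e orbb => /lt_arc; lia.
  apply/val_inj; have := fP (f x); have := fP x.
  case/orP => a /orP[] b.
  + by have [_] := arc_l a; have [->] := arc_l b.
  + exact: (arc_uniql b a).
  + exact: (arc_uniqr b a).
  + by have [_] := arc_l b; have [->] := arc_l a.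
- by case/orP: (fP x) => [/arc_l//|/lt_arc/ltnW]; rewrite leqNgt xf.
- apply/negP => /and3P[h1 h2 h3].
  have a : arc x (f x) by case/orP: (fP x) => // /lt_arc/ltnW; rewrite leqNgt (ltn_trans h1 h2).
  have b : arc y (f y) by case/orP: (fP y) => // /lt_arc/ltnW; rewrite leqNgt (ltn_trans h2 h3).
  by have := arc_nocross a b; rewrite h1 h2 h3.
Qed.

Lemma matching_up f (x : 'I_N) : matching f -> l x -> x < f x.
Proof.
case=> inv lab _ lx; case: (ltngtP x (f x)) => // [lt|e].
  by case: (lab (f x)); rewrite (proj2 (inv x)) ?lx.
by case/eqP: (proj1 (inv x)); exact/val_inj.
Qed.

Lemma matching_down f (x : 'I_N) : matching f -> l x = false -> f x < x.
Proof.
case=> inv lab _ lx; case: (ltngtP x (f x)) => // [/lab[]|e]; first by rewrite lx.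
by case/eqP: (proj1 (inv x)); exact/val_inj.
Qed.

(* Infinite descent: a [+] whose [f]-arc is shorter than its [g]-arc yields another one strictly inside. *)
Lemma matching_le f g (x : 'I_N) : matching f -> matching g -> l x -> g x <= f x.
Proof.
move=> mf mg; have [d] := ubnP (f x - x); elim: d x => // d IH x dx lx.
rewrite leqNgt; apply/negP => fg.
have xf := matching_up mf lx.
have [If Lf Cf] := mf; have [Ig Lg Cg] := mg.
have [_ ly] := Lf _ xf.
have gy := matching_down mg ly.
set x' := g (f x) in gy.
have gx' : g x' = f x by rewrite /x' (proj2 (Ig _)).
have xx' : x' != x by apply/eqP => e; move: fg; rewrite -gx' e ltnn.
have lx' : l x' by case: (Lg x'); rewrite gx'.
have lt : x < x'.
  rewrite ltn_neqAle; apply/andP; split.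
    by apply/eqP => e; case/eqP: xx'; apply/val_inj.
  rewrite leqNgt; apply/negP => x'x.
  by have := Cg x' x; rewrite gx' x'x xf fg.
have fx' := matching_up mf lx'.
have fx'lt : f x' < f x.
  rewrite ltn_neqAle; apply/andP; split.
    apply/eqP => e; case/eqP: xx'.
    by rewrite -(proj2 (If x')) -(proj2 (If x)); congr (f _); apply/val_inj.
  by rewrite leqNgt; apply/negP => H; have := Cf x x'; rewrite lt gy H.
have := IH x' _ lx'; rewrite gx'; lia.
Qed.

Lemma matching_uniq f g (x : 'I_N) : matching f -> matching g -> f x = g x.
Proof.
move=> mf mg.
have plus (y : 'I_N) : l y -> f y = g y.
  move=> ly; apply/val_inj/eqP; rewrite /= eqn_leq.
  by rewrite !matching_le.
case lx: (l x); first exact: plus.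
have [If Lf _] := mf; have [Ig _ _] := mg.
have lf : l (f x).
  by case: (Lf (f x)) => //; rewrite (proj2 (If x)) matching_down.
have := plus _ lf; rewrite (proj2 (If x)) => e.
by rewrite [in RHS]e (proj2 (Ig _)).
Qed.

Lemma matching_target f (x y : 'I_N) : matching f -> arc x y -> y = f x.
Proof.
move=> mf a; have [f0 [m0 H]] := matching_exists; have [lx _] := arc_l a.
by rewrite (matching_uniq x mf m0); apply/val_inj/(arc_uniqr a)/H.
Qed.

Lemma matching_arc f (x y : 'I_N) : matching f ->
  (y == f x) && (x < y) = arc x y.
Proof.
move=> mf; apply/andP/idP => [[/eqP -> xf]|a].
  have [_ L _] := mf; have [lx _] := L _ xf.
  have [z zN a] := arc_from (ltn_ord x) lx.
  by rewrite -(matching_target (y := Ordinal zN) mf a).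
have /arcP[xy _ _] := a; split=> //.
by rewrite (matching_target mf a).
Qed.

End Heights.

(** * Cups on the positive half-line *)

Section Partners.
Variable l : nat -> bool.

(* The unmatched [+]'s and the [-]'s without a [+] to their left to match, latest first, among the letters [l 0], ..., [l k.-1]. *)
Fixpoint scan (k : nat) : seq nat * seq nat :=
  if k is j.+1 then
    let: (s, r) := scan j in
    if l j then (j :: s, r) else if s is _ :: s' then (s', r) else ([::], j :: r)
  else ([::], [::]).

(* [Some (true, a)]: undotted cup from [a] to [k]; [Some (false, a)]: dotted cup, i.e. a linked pair, at [a] and [k]. *)
Definition left_end (k : nat) : option (bool * nat) :=
  if l k then None else
  match scan k with
  | (a :: _, _) => Some (true, a)
  | ([::], r) => if odd (size r) then Some (false, head 0 r) else None
  end.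

Variable v : nat -> bool.

Definition cup_ok (k : nat) : bool :=
  if left_end k is Some (d, a) then v k == d (+) v a else true.
Definition cup_cw (k : nat) : bool := (left_end k != None) && v k.

(** The stack of [exec] rebuilt from positions. With an odd number of records, the latest one is a
    dotted cup still open, at the bottom. *)
Definition scan_stack (k : nat) : seq bool :=
  let: (s, r) := scan k in
  [seq ~~ v a | a <- s] ++ (if odd (size r) then [:: v (head 0 r)] else [::]).

Local Open Scope ring_scope.
Lemma run_scan (K : fieldType) (q : K) m k :
  exec q (@closing K) (scan_stack k) [seq l j | j <- iota k m] [seq v j | j <- iota k m]
  = (if all cup_ok (iota k m) then q ^+ (\sum_(j <- iota k m) cup_cw j)%N else 0)
    * closing K (scan_stack (k + m)).
Proof.
elim: m k => [|m IH] k /=; first by rewrite big_nil expr0 mul1r addn0.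
rewrite big_cons -addSnnS.
move: (IH k.+1); set A := all _ _; set B := (\sum_(j <- iota k.+1 m) _)%N.
set C := closing _ _; clearbody A B C; rewrite /cup_ok /cup_cw /left_end /scan_stack [scan k.+1]/=.
case: (scan k) => s r; case: (l k) => /= [->//|].
case: s => [|a s] /=.
  case: (odd (size r)) => /= e; last by rewrite e.
  case: eqP => //= _; last by rewrite mul0r.
  by rewrite e; case: (A); rewrite ?mul0r ?mulr0 // exprD mulrA.
move=> e; case: eqP => //= _; last by rewrite mul0r.
by rewrite e; case: (A); rewrite ?mul0r ?mulr0 // exprD mulrA.
Qed.
Local Close Scope ring_scope.

End Partners.

(** * Symmetric diagrams and their right halves *)

Section Center.
Variables (L : nat -> bool) (c : nat).
Notation hL := (ht L).
Hypothesis ht_sym : forall k, k <= c -> hL (c - k) = hL (c + k).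
Let l k := L (c + k).
Let g k := hL (c + k).

Lemma g_step k : g k.+1 = (g k + (if l k then 1 else -1))%R.
Proof. by rewrite /g addnS htS. Qed.

Lemma ht_mirror k : k <= c + c -> hL (c + c - k) = hL k.
Proof.
move=> kc; case: (leqP k c) => H.
  have := ht_sym (k := c - k); rewrite subKn // => ->; last exact: leq_subr.
  by congr (ht _ _); lia.
have := ht_sym (k := k - c); rewrite (subnKC (ltnW H)) => <-; last lia.
by congr (ht _ _); lia.
Qed.

Lemma arc_mirror x y : y < c + c -> arc L x y ->
  arc L (c + c - y.+1) (c + c - x.+1).
Proof.
move=> yc /arcP[xy e a]; apply/arcP; split=> [||z h1 h2]; first lia.
  have -> : (c + c - x.+1).+1 = c + c - x by lia.
  by rewrite !ht_mirror //; lia.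
rewrite ht_mirror // e -(@ht_mirror z); last lia.
by apply: a; lia.
Qed.

(** Each record lowers the running minimum of the path by one. The stack depth is the height above
    that minimum, and the stack holds, for each level in between, the last [+] that left this
    level. *)
Lemma scan_ht k : [/\
  ((size (scan l k).1)%:Z = g k - g 0 + (size (scan l k).2)%:Z)%R,
  forall z, z <= k -> (g 0 - (size (scan l k).2)%:Z <= g z)%R &
  forall i, i < size (scan l k).1 ->
    let a := nth 0 (scan l k).1 i in
    [/\ l a, a < k, g a = (g k - 1 - i%:Z)%R &
        forall z, a < z -> z <= k -> (g a < g z)%R]].
Proof.
elim: k => [|k] /=.
  by split=> [|z|//]; [rewrite subrr | case: z; rewrite // subr0].
have gS := g_step k.
case: (scan l k) => s r /= [sz mn st].
case lk: (l k) gS => gS /=.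
  split=> [|z zk|[|i] /= si]; first lia.
  - have [H|->] : z <= k \/ z = k.+1 by lia.
      exact: mn.
    by have := mn _ (leqnn k); lia.
  - split=> [//|//||z kz zk]; first lia.
    by have -> : z = k.+1 by [lia]; lia.
  - have [la ak ga az] := st _ si; split=> [//|||z zz zk]; [lia|lia|].
    have [H|->] : z <= k \/ z = k.+1 by lia.
      exact: az.
    by have := az k ak (leqnn k); lia.
case: s sz st => [|a s] /= sz st.
  split=> [|z zk|//]; first lia.
  have [H|->] : z <= k \/ z = k.+1 by lia.
    by have := mn _ H; lia.
  lia.
split=> [|z zk|i si]; first lia.
  have [H|->] : z <= k \/ z = k.+1 by lia.
    exact: mn.
  by have [_ _ ga _] := st 0 isT; have := mn _ (leqnn k); move: sz => /=; lia.
have /= [la ak ga az] := st i.+1 si; rewrite /=; split=> [//|||z zz zk]; [lia|lia|].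
have [H|->] : z <= k \/ z = k.+1 by lia.
  exact: az.
lia.
Qed.

(** The top of the stack starts an arc by [scan_ht], and a right end has only one arc. With an empty
    stack, letter [k] would take the path below every earlier height of the right half, so no arc
    could end there. *)
Lemma left_end_arc k a :
  left_end l k = Some (true, a) <-> arc L (c + a) (c + k).
Proof.
have arc_left b s r : scan l k = (b :: s, r) -> l k = false ->
    arc L (c + b) (c + k).
  move=> e lk; have [_ _ /(_ 0)] := scan_ht k; rewrite e => /(_ isT) /= [_ bk gb bz].
  have gS := g_step k; rewrite lk in gS.
  apply/arcP; split; first lia.
    by rewrite -addnS -/(g k.+1) -/(g b); lia.
  move=> z h1 h2; have := bz (z - c); rewrite /g subnKC; last lia.
  by apply; lia.
rewrite /left_end; split.
  case lk: (l k) => //; case e: (scan l k) => [[|b s] r].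
    by case: odd.
  by case=> <-; exact: arc_left e lk.
move=> A; have [_] := arc_l A; rewrite -/(l k) => lk; rewrite lk.
case e: (scan l k) => [[|b s] r]; last first.
  by have := arc_uniql A (arc_left _ _ _ e lk) => /addnI ->.
have /arcP[ak gk _] := A; have [sz mn _] := scan_ht k.
have := mn a; have gS := g_step k; rewrite lk in gS.
move: sz; rewrite e /= => sz.
move: gk; rewrite -addnS -/(g k.+1) -/(g a) => gk.
have ak' : a <= k by lia.
move=> /(_ ak'); lia.
Qed.

(** The path is a palindrome. An arc ending beyond the mirror image of its start would contain that
    image, and one ending before it would contain the image of its end; either is a forbidden return
    to the base level. *)
Lemma crossing_arc x y : x < c -> c <= y -> arc L x y -> x = c + c - y.+1.
Proof.
move=> xc cy /arcP[xy e a].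
have yc : y.+1 <= c + c.
  rewrite leqNgt; apply/negP => lt; have := a (c + c - x).
  have := ht_sym (k := c - x); rewrite subKn; last lia.
  have -> : c + (c - x) = c + c - x by lia.
  move=> H1 H2; have h2 : x < c + c - x by lia.
  have h3 : c + c - x <= y by lia.
  have := H2 h2 h3; rewrite -H1 ?ltxx //; lia.
case: (ltngtP x (c + c - y.+1)) => // lt.
- have := a (c + c - y.+1).
  have := ht_sym (k := y.+1 - c).
  have -> : c - (y.+1 - c) = c + c - y.+1 by lia.
  have -> : c + (y.+1 - c) = y.+1 by lia.
  move=> H1 H2; have h2 : y.+1 - c <= c by lia.
  have := H2 lt; rewrite (H1 h2) e ltxx => H.
  by have : false by apply: H; lia.
- have := a (c + c - x).
  have := ht_sym (k := c - x); rewrite subKn; last lia.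
  have -> : c + (c - x) = c + c - x by lia.
  move=> H1 H2; have h2 : x < c + c - x by lia.
  have h3 : c + c - x <= y by lia.
  have := H2 h2 h3; rewrite -H1 ?ltxx //; lia.
Qed.

(** A record goes below all earlier heights of the right half and, by symmetry, below their mirror
    images, so it is joined to its own mirror image. *)
Lemma record_arc k : k < c ->
  ~~ l k && (size (scan l k).1 == 0) = arc L (c - k.+1) (c + k).
Proof.
move=> kc; have [sz mn st] := scan_ht k; have gS := g_step k.
apply/andP/idP => [[/negbTE lk /eqP s0]|A].
  rewrite lk in gS; apply/arcP; split=> [||z h1 h2]; first lia.
    by rewrite -addnS ht_sym.
  have -> : (hL (c - k.+1) = g k - 1)%R by rewrite ht_sym // -/(g _); lia.
  case: (leqP c z) => H.
    have := mn (z - c); rewrite {2}/g subnKC // => /(_ ltac:(lia)); lia.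
  have := mn (c - z); rewrite {2}/g -ht_sym ?subKn; [|lia|lia].
  move=> /(_ ltac:(lia)); lia.
have [_ lk] := arc_l A; have /arcP[_ e a] := A.
rewrite -/(l k) in lk; rewrite lk in gS; split; first by rewrite lk.
rewrite eqn0Ngt; apply/negP => /st /= [_ ak ga _].
have := a (c + nth 0 (scan l k).1 0); rewrite -e -addnS -/(g k.+1) -/(g (nth _ _ _)).
by move=> /(_ ltac:(lia) ltac:(lia)); lia.
Qed.

Definition records k := rev (scan l k).2.

Lemma records_nth k i : i < size (records k) ->
  let y := nth 0 (records k) i in
  [/\ y < k, ~~ l y, (scan l y).1 = [::] & (scan l y).2 = rev (take i (records k))].
Proof.
elim: k => [//|k]; rewrite /records /=.
case e: (scan l k) => [s r] /= IH.
have wk : i < size (rev r) -> let y := nth 0 (rev r) i in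
   [/\ y < k.+1, ~~ l y, (scan l y).1 = [::] & (scan l y).2 = rev (take i (rev r))].
  by move=> /IH /= [/leqW].
case lk: (l k); first exact: wk.
case: s e => [|a s] e; last exact: wk.
rewrite /= rev_cons size_rcons ltnS nth_rcons leq_eqVlt.
rewrite -cats1 take_cat; case: ltnP => [lt _|ge]; first exact: wk.
rewrite orbF => /eqP ie; rewrite ie subnn /= eqxx lk e cats0.
by split; rewrite //= revK.
Qed.

Lemma mem_records k y : (y \in records k) =
  [&& y < k, ~~ l y & size (scan l y).1 == 0].
Proof.
apply/idP/idP => [yr|/and3P[yk ly sy]].
  have := records_nth (k := k) (i := index y (records k)); rewrite index_mem => /(_ yr).
  by rewrite /= nth_index // => -[-> -> -> _].
elim: k yk => [//|k IH]; rewrite ltnS leq_eqVlt /records /=.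
case e: (scan l k) => [s r] /= /orP[/eqP yk|/IH].
  move: sy ly; rewrite yk e; case: (l k); case: s {e} => //= _ _.
  by rewrite mem_rev mem_head.
rewrite /records e /= mem_rev; case: (l k) => /=; first by rewrite mem_rev.
by case: s {e} => [|a s]; rewrite /= mem_rev // inE => ->; rewrite orbT.
Qed.

Lemma records_sorted k : sorted ltn (records k).
Proof.
rewrite /records rev_sorted; elim: k => [//|k] /=.
have := mem_records k; rewrite /records.
case: (scan l k) => [s r] /= H IH; case: (l k) => //; case: s => //=.
rewrite path_min_sorted //; apply/allP => y yr.
by have := H y; rewrite mem_rev yr => /esym/and3P[].
Qed.

(** Indices start at 0, so [y_{2j-1}] has an even index and [y_{2j}], which closes the dotted cup,
    the odd index after it. *)
Lemma left_end_record k i : i < size (records k) ->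
  left_end l (nth 0 (records k) i)
  = if odd i then Some (false, nth 0 (records k) i.-1) else None.
Proof.
move=> ir; have [_ /negbTE ly s1 s2] := records_nth ir.
rewrite /left_end ly; case: (scan _ _) s1 s2 => s r /= -> ->.
rewrite size_rev size_takel ?(ltnW ir) //.
case: i ir {ly} => [//|i] ir; case: odd => //=; congr (Some (_, _)).
by rewrite -nth0 nth_rev size_takel ?(ltnW ir) // subn1 nth_take.
Qed.

Lemma left_end_dotted k m a : k < m -> left_end l k = Some (false, a) ->
  exists2 i, i.+1 < size (records m) & [/\ odd i.+1, k = nth 0 (records m) i.+1 &
    a = nth 0 (records m) i].
Proof.
move=> km H; have kr : k \in records m.
  rewrite mem_records km /=; move: H; rewrite /left_end.
  by case: (l k) => //; case: (scan l k) => [[|b s] r].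
move: (kr); rewrite -index_mem => ir; have := left_end_record ir.
rewrite nth_index // H; case: ifP => //; case e: index ir => [|i] // ir oi [->].
by exists i => //; split=> //; rewrite -e nth_index.
Qed.

End Center.

(** * Cup diagrams of Weyl group elements *)

Lemma sum_pairs (f : nat -> nat) m :
  (forall j, j < m -> f j.*2 = f j.*2.+1) ->
  \sum_(i < m.*2) f i = (\sum_(i < m.*2) odd i * f i).*2.
Proof.
elim: m => [|m IH] H; first by rewrite !big_ord0.
rewrite doubleS !big_ord_recr /= IH => [|j jm]; last by apply: H; lia.
rewrite /= odd_double -(H m (leqnn _)) /=; move: (\sum_(i < _) _) => S; lia.
Qed.

Section Bridge.
Variable n : nat.
Implicit Types w v : gT n.
Notation c := (2 * n).

Definition signs w : seq bool := mkseq (alpha w) n.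

Definition label w (p : nat) : bool :=
  if p < n then true
  else if p < c then ~~ alpha w (c - p).-1
  else if p < 3 * n then alpha w (p - c)
  else false.

Definition half w (k : nat) : bool := label w (c + k).

Lemma labE w (p : pt n) : lab w p = label w p. Proof. by []. Qed.

Lemma halfE w k : half w k = (k < n) && alpha w k.
Proof.
rewrite /half /label; have -> : c + k - c = k by lia.
by do !case: ifP; lia.
Qed.

Lemma label_mirror w p : p < 4 * n -> label w (4 * n - p.+1) = ~~ label w p.
Proof.
move=> pn; rewrite /label.
case: (ltnP p n) => h1.
  by have [-> -> ->] : [/\ 4 * n - p.+1 < n = false, 4 * n - p.+1 < c = false
    & 4 * n - p.+1 < 3 * n = false] by split; lia.
case: (ltnP p c) => h2.
  have [-> -> ->] : [/\ 4 * n - p.+1 < n = false, 4 * n - p.+1 < c = false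
    & 4 * n - p.+1 < 3 * n = true] by split; lia.
  by rewrite negbK; congr (alpha w _); lia.
case: (ltnP p (3 * n)) => h3.
  have [-> ->] : [/\ 4 * n - p.+1 < n = false & 4 * n - p.+1 < c = true] by split; lia.
  by congr (~~ alpha w _); lia.
by have -> : 4 * n - p.+1 < n = true by lia.
Qed.

Lemma lab_mirror w (p : pt n) : lab w (mirror p) = ~~ lab w p.
Proof. by rewrite !labE /mirror /= label_mirror. Qed.

Lemma ht_label_sym w k : k <= c -> ht (label w) (c - k) = ht (label w) (c + k).
Proof.
elim: k => [|k IH] kc; first by rewrite subn0 addn0.
have := IH (ltnW kc); have -> : c - k = (c - k.+1).+1 by lia.
rewrite addnS !htS => H; have := label_mirror w (p := c - k.+1).
have -> : 4 * n - (c - k.+1).+1 = c + k by lia.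
move=> /(_ ltac:(lia)) ->; move: H; case: (label w _) => /=; lia.
Qed.

(** The [n] leading [+] lift the path to [n], the next [n] letters cannot take it below 0, and the
    right half mirrors the left. *)
Lemma ht_label_ge0 w k : k <= 4 * n -> (0 <= ht (label w) k)%R.
Proof.
have up j : j <= n -> (ht (label w) j = j%:Z)%R.
  elim: j => [//|j IH] jn; rewrite htS IH 1?ltnW //.
  by rewrite /label jn; lia.
have down j : (n%:Z - j%:Z <= ht (label w) (n + j))%R.
  elim: j => [|j IH]; first by rewrite addn0 up //; lia.
  by rewrite addnS htS; case: (label w _); lia.
have lo j : j <= c -> (0 <= ht (label w) j)%R.
  move=> jc; case: (leqP j n) => jn; first by rewrite up.
  by have := down (j - n); rewrite subnKC ?(ltnW jn) //; lia.
move=> kn; case: (leqP k c) => kc; first exact: lo.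
have := ht_label_sym w (k := k - c); rewrite subnKC ?(ltnW kc) // => <-; last lia.
by apply: lo; lia.
Qed.

Lemma ht_labelN w : ht (label w) (4 * n) = 0%R.
Proof.
have := ht_label_sym w (leqnn c); rewrite subnn.
by have -> : c + c = 4 * n by lia.
Qed.

Lemma isCupMatchingP w (f : {ffun pt n -> pt n}) :
  reflect (matching (label w) f) (isCupMatching w f).
Proof.
apply: (iffP idP) => [/andP[/andP[/forallP a /forallP b] /forallP d]|[a b d]].
  split=> [x|x xf|x y]; first by have /andP[-> /eqP ->] := a x.
    by have := b x; rewrite xf !labE => /andP[-> /negbTE ->].
  by have /forallP := d x.
apply/andP; split; [apply/andP; split|]; apply/forallP => x.
- by have [-> ->] := a x; rewrite eqxx.
- by apply/implyP => /b[]; rewrite !labE => -> ->.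
- by apply/forallP => y; apply: d.
Qed.

Lemma arcs0E w x y : ((x, y) \in arcs0 w) = arc (label w) x y.
Proof.
rewrite /arcs0; case: pickP => [f /isCupMatchingP mf|no].
  rewrite inE /= (matching_arc (ht_label_ge0 w) (ht_labelN w)) //.
have [f [/isCupMatchingP mf _]] := matching_exists (ht_label_ge0 w) (ht_labelN w).
by rewrite no in mf.
Qed.

Notation R w := (records (label w) c c).

Lemma mem_Ys w (y : pt n) : (y \in Ys w) = ~~ isneg y && (val y - c \in R w).
Proof.
rewrite mem_filter mem_enum andbT mem_records.
have yn := ltn_ord y.
apply/existsP/andP => [[x]|[ny]].
  rewrite arcs0E /crossing /= => /andP[a /andP[nx ny]]; split=> //.
  rewrite /isneg -leqNgt in nx ny.
  have := record_arc (ht_label_sym w) (k := y - c); rewrite subnKC //.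
  move=> ->; last lia.
  have {}nx : (x : nat) < c by [].
  have {}ny : c <= (y : nat) by [].
  have := crossing_arc (ht_label_sym w) nx ny a.
  move=> xE; have -> : c - (y - c).+1 = x by lia.
  by rewrite a; apply/andP; split=> //; lia.
case/andP => yc; rewrite /isneg -leqNgt in ny.
have {}ny : c <= (y : nat) by [].
have {}yc : (y : nat) - c < c by [].
rewrite (record_arc (ht_label_sym w) yc) subnKC // => a.
have xn : c - (y - c).+1 < 4 * n by lia.
exists (Ordinal xn); rewrite arcs0E a /crossing /isneg /= -leqNgt ny andbT; lia.
Qed.

Lemma val_Ys w : map val (Ys w) = map (addn c) (R w).
Proof.
have s1 : sorted ltn (map val (Ys w)).
  apply: (subseq_sorted ltn_trans _ (iota_ltn_sorted 0 (4 * n))).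
  by rewrite -val_enum_ord; apply/map_subseq/filter_subseq.
have s2 : sorted ltn (map (addn c) (R w)).
  rewrite sorted_map; apply: sub_sorted (records_sorted (label w) c c) => a b /=.
  by rewrite ltn_add2l.
apply: (irr_sorted_eq ltn_trans ltnn s1 s2) => z.
apply/mapP/mapP => [[y]|[k kr ->]].
  rewrite mem_Ys => /andP[ny yr] ->; exists (val y - c) => //.
  by rewrite subnKC // leqNgt.
have kc : k < c by move: kr; rewrite mem_records => /andP[].
have kn : c + k < 4 * n by lia.
exists (Ordinal kn) => //; rewrite mem_Ys /isneg /= -leqNgt leq_addr /=.
by rewrite addKn.
Qed.

Lemma size_Ys w : size (Ys w) = size (R w).
Proof. by rewrite -(size_map val) val_Ys size_map. Qed.

Lemma nth_Ys w p0 i : i < size (R w) -> nth p0 (Ys w) i = c + nth 0 (R w) i :> nat.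
Proof.
move=> ir; have := nth_map p0 0 val (s := Ys w) (n := i).
by rewrite size_Ys val_Ys (nth_map 0) // => /(_ ir).
Qed.

(** Every [+] is matched in the full diagram, so none remains on the stack. The number of records is
    then the difference of the heights at [2n] and [4n], both even. *)
Lemma scan_end w : (scan (half w) c).1 = [::] /\ ~~ odd (size (R w)).
Proof.
have [sz _ st] := scan_ht (label w) c c.
have s0 : (scan (half w) c).1 = [::].
  apply/eqP; rewrite -size_eq0 eqn0Ngt; apply/negP => /st /= [la ak _ az].
  set a := nth 0 _ 0 in la ak az.
  have cn : c + a < 4 * n by lia.
  have [y yn /arcP[ay e _]] := arc_from (ht_label_ge0 w) (ht_labelN w) cn la.
  have := az (y.+1 - c); rewrite subnKC; last lia.
  by rewrite e ltxx => H; have : false by apply: H; lia.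
split=> //; move: sz; rewrite -/(half w) s0 /records size_rev /=.
have par k : exists m : nat, (ht (label w) k = k%:Z - 2 * m%:Z)%R.
  elim: k => [|k [m e]]; first by exists 0.
  by rewrite htS e; case: (label w k); [exists m | exists m.+1]; lia.
have [m ->] := par (c + c); have [m' ->] := par (c + 0).
by move: (size _) => r; lia.
Qed.

(** The [n] letters beyond the sign sequence are [-] labeled [false]; by [run_diag], reading them
    amounts to [closing]. *)
Lemma run_signs (K : fieldType) (q : K) w v :
  exec q (@closing K) [::] (signs w) (signs v)
  = if all (cup_ok (half w) (half v)) (iota 0 c)
    then (q ^+ \sum_(j <- iota 0 c) cup_cw (half w) (half v) j)%R else 0%R.
Proof.
have := run_scan (half w) (half v) q c 0.
have [s0] := scan_end w; rewrite /records size_rev -/(half w) => r0.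
rewrite {2}/scan_stack add0n.
case: (scan (half w) c) s0 r0 => s r /= -> /negbTE -> /=.
rewrite /closing /= mulr1 => <-.
have sp u : [seq half u j | j <- iota 0 c] =
    signs u ++ [seq false | _ <- iota n n].
  have -> : c = n + n by lia.
  rewrite iotaD map_cat add0n; congr (_ ++ _).
    by apply/eq_in_map => j; rewrite mem_iota halfE => /andP[_ ->].
  by apply/eq_in_map => j; rewrite mem_iota halfE leqNgt => /andP[/negbTE ->].
rewrite !sp exec_cat ?size_mkseq //.
by apply: eq_exec => S; rewrite run_diag.
Qed.

Definition linked w (y : pt n) : pt n :=
  nth y (Ys w) (partner (index y (Ys w))).

Lemma isnegN (p : pt n) : ~~ isneg p = (c <= (p : nat)).
Proof. by rewrite /isneg -leqNgt. Qed.

Lemma Ys_index w (y : pt n) : y \in Ys w ->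
  let i := index y (Ys w) in
  [/\ i < size (R w), partner i < size (R w), val y - c = nth 0 (R w) i &
      val (linked w y) = c + nth 0 (R w) (partner i) ].
Proof.
move=> yY i; have iR : i < size (R w) by rewrite -size_Ys index_mem.
have [_ ev] := scan_end w.
have pR : partner i < size (R w).
  by rewrite /partner; case: ifP => oi; move: iR; lia.
split=> //; last exact: nth_Ys.
have := nth_Ys (w := w) y iR; rewrite nth_index // => e.
have -> : \val y = c + nth 0 (R w) i by [].
by rewrite addKn.
Qed.

(** A cup on the negative side has the negated labels of its mirror image, hence the same condition.
    Both cups of a linked pair ask that the labels at [y_{2j-1}] and [y_{2j}] agree. *)
Lemma orientedE w v : oriented v w = all (cup_ok (half w) (half v)) (iota 0 c).
Proof.
have labv (p : pt n) : c <= (p : nat) -> lab v p = half v (p - c).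
  by move=> cp; rewrite labE /half subnKC.
have okeq (a b : bool) : (a != b) = (b == ~~ a) by case: a; case: b.
apply/forallP/allP => [H k|H [x y]].
  rewrite mem_iota add0n /= => kc; rewrite /cup_ok.
  have kn : c + k < 4 * n by lia.
  case e: (left_end _ k) => [[[] a]|//] /=.
    have /(left_end_arc (label w) c) A := e; have /arcP[ak _ _] := A.
    have an : c + a < 4 * n by lia.
    have := H (Ordinal an, Ordinal kn).
    rewrite in_setU inE arcs0E /= A /crossing /isneg /=.
    have -> : (c + a < c) = false by lia.
    rewrite /=.
    by rewrite !labv /= ?leq_addr // !addKn okeq.
  have [i iR [oi kE aE]] := left_end_dotted kc e.
  have yY : Ordinal kn \in Ys w.
    rewrite mem_Ys isnegN /= leq_addr addKn kE; apply: mem_nth.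
    exact: iR.
  have := Ys_index yY; set j := index _ _ => -[jR pR yE lE].
  have ji : j = i.+1.
    move: yE; rewrite /= addKn kE => /eqP; rewrite nth_uniq //.
      by move/eqP.
    exact: sorted_uniq ltn_trans ltnn _ (records_sorted _ _ _).
  have := H (mirror (linked w (Ordinal kn)), Ordinal kn).
  rewrite in_setU; have -> : (mirror (linked w (Ordinal kn)), Ordinal kn) \in
    [set (mirror (linked w y), y) | y in Ys w] by apply: imset_f.
  rewrite orbT /= lab_mirror !labv /= ?lE ?leq_addr // !addKn ji /partner oi /= -aE.
  by case: (half v a); case: (half v k).
apply/implyP; rewrite in_setU => /orP[].
  rewrite inE arcs0E /crossing /= => /andP[A].
  have up (x' y' : pt n) : c <= (x' : nat) -> arc (label w) x' y' ->
      lab v x' != lab v y'.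
    move=> cx A'; have /arcP[xy _ _] := A'.
    have := H (y' - c); rewrite mem_iota /cup_ok.
    have -> : left_end (half w) (y' - c) = Some (true, x' - c).
      by apply/(left_end_arc (label w) c); rewrite !subnKC //; lia.
    rewrite !labv ?okeq //; last lia.
    by apply; have := ltn_ord y'; lia.
  rewrite negb_and negbK isnegN => /orP[nx|ny]; first exact: up.
  have := up (mirror y) (mirror x).
  rewrite !lab_mirror (inj_eq negb_inj) eq_sym; apply.
    by move: ny; rewrite /isneg /mirror /= => ny; have {}ny : (y : nat) < c by []; lia.
  have := arc_mirror (ht_label_sym w) _ A; rewrite /mirror /=.
  have -> : c + c = 4 * n by lia.
  by apply; have := ltn_ord y; lia.
case/imsetP => y' yY [-> ->] {x y} /=.
have [iR pR yE lE] := Ys_index yY.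
have cy : c <= (y' : nat) by move: yY; rewrite mem_Ys isnegN => /andP[].
rewrite lab_mirror !labv // ?lE ?leq_addr // addKn.
rewrite -[(y' : nat)]/(val y') yE.
move: iR pR; set i := index _ _; rewrite /partner => iR pR.
have ineq j : odd j -> j < size (R w) ->
    half v (nth 0 (R w) j) == half v (nth 0 (R w) j.-1).
  move=> oj jR; have := H (nth 0 (R w) j).
  rewrite mem_iota /cup_ok (left_end_record jR) oj; apply.
  by rewrite add0n /=; have [] := records_nth jR.
rewrite okeq negbK; case: ifP pR => oi pR; first exact: ineq.
by rewrite eq_sym; apply: ineq => //=; rewrite oi.
Qed.

Lemma card_upper (P : pred nat) :
  #|[set y : pt n | ~~ isneg y && P (val y - c)]| = \sum_(k <- iota 0 c) P k.
Proof.
rewrite cardsE cardE size_filter -enumT /=.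
have -> : count (mem [pred y : pt n | ~~ isneg y && P (val y - c)]) (enum (pt n))
  = count (fun p => (c <= p) && P (p - c)) (iota 0 (4 * n)).
  by rewrite -val_enum_ord count_map; apply: eq_count => y; rewrite !inE isnegN.
have -> : 4 * n = c + c by lia.
rewrite iotaD count_cat [X in X + _](_ : _ = 0); last first.
  by apply/eqP; rewrite eqn0Ngt -has_count; apply/hasPn => p; rewrite mem_iota; lia.
have -> : iota (0 + c) c = map (addn c) (iota 0 c) by rewrite -iotaDl addn0.
rewrite add0n count_map -sum1_count big_mkcond.
by apply: eq_bigr => k _ /=; rewrite leq_addr addKn; case: (P k).
Qed.

Lemma sum_records w (f : nat -> nat) :
  \sum_(k <- iota 0 c | k \in R w) f k = \sum_(i < size (R w)) f (nth 0 (R w) i).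
Proof.
rewrite -(big_mkord predT (fun i => f (nth 0 (R w) i))) -(big_nth 0 predT f) -big_filter.
apply/perm_big/uniq_perm; first exact/filter_uniq/iota_uniq.
  exact: sorted_uniq ltn_trans ltnn _ (records_sorted _ _ _).
move=> k; rewrite mem_filter mem_iota add0n.
by case kr: (k \in _) => //=; move: kr; rewrite mem_records => /andP[].
Qed.

Lemma clE w v : oriented v w ->
  cl v w = (\sum_(j <- iota 0 c) cup_cw (half w) (half v) j).*2.
Proof.
move=> ori; have /forallP oriP := ori; rewrite orientedE in ori.
pose isU k := if left_end (half w) k is Some (true, _) then half v k else false.
pose isD k := if left_end (half w) k is Some (false, _) then half v k else false.
have labv (p : pt n) : c <= (p : nat) -> lab v p = half v (p - c).
  by move=> cp; rewrite labE /half subnKC.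
(* In an oriented diagram the right label alone decides whether a cup is clockwise. The clockwise
   cups split into those on the positive side, those on the negative side and the linked ones. *)
pose Ap := [set xy in arcs0 w | ~~ isneg xy.1 && lab v xy.2].
pose An := [set xy in arcs0 w | isneg xy.2 && lab v xy.2].
pose B := [set (mirror (linked w y), y) | y in [set y | (y \in Ys w) && lab v y]].
have arclt (x y : pt n) : (x, y) \in arcs0 w -> x < y.
  by rewrite arcs0E => /arcP[].
have arcor (x y : pt n) : (x, y) \in arcs0 w -> ~~ isneg x || isneg y ->
    lab v x != lab v y.
  move=> a nc; apply: (implyP (oriP (x, y))).
  by rewrite in_setU inE a /crossing negb_and negbK nc.
have cupsE : [set xy in cups w | ~~ lab v xy.1 && lab v xy.2] = Ap :|: An :|: B.
  have [C CE] : exists C, C = cups w by exists (cups w).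
  rewrite -CE; apply/setP => -[x y]; rewrite !inE /=; apply/andP/idP.
    case=> xyc /andP[lx ly]; move: xyc; rewrite CE in_setU => /orP[].
      rewrite inE /= ly !andbT => /andP[-> ]; rewrite /crossing negb_and negbK /=.
      by case: (isneg x); case: (isneg y).
    case/imsetP => y' yY [xE yE]; apply/orP; right; apply/imsetP; exists y'.
      by rewrite inE yY -yE.
    by rewrite -xE -yE.
  case/orP => [/orP[]/and3P[a nx ly]|].
  + have nc : ~~ isneg x || isneg y by rewrite nx.
    rewrite CE in_setU inE a /crossing negb_and negbK nc ly andbT.
    by have := arcor _ _ a nc; rewrite ly; case: (lab v x).
  + have nc : ~~ isneg x || isneg y by rewrite nx orbT.
    rewrite CE in_setU inE a /crossing negb_and negbK nc ly andbT.
    by have := arcor _ _ a nc; rewrite ly; case: (lab v x).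
  + case/imsetP => y'; rewrite inE => /andP[yY ly] [-> ->].
    have inc : (mirror (linked w y'), y') \in cups w.
      by rewrite in_setU orbC imset_f.
    rewrite CE; split=> //; have := implyP (oriP _) inc; rewrite /= ly.
    by case: (lab v _).
rewrite /cl cupsE.
have dB : [disjoint Ap :|: An & B].
  rewrite -setI_eq0; apply/eqP/setP => -[x y]; rewrite !inE; apply/negbTE/negP.
  case/andP => H /imsetP[y']; rewrite inE => /andP[yY _] [xE yE].
  have [_ pR _ lE] := Ys_index yY.
  have := mem_nth 0 pR; rewrite mem_records => /andP[pc _].
  have nx : isneg x.
    have e : (linked w y' : nat) = c + nth 0 (R w) (partner (index y' (Ys w))) by [].
    by rewrite xE /isneg /mirror /= e; lia.
  have ny : ~~ isneg y by rewrite yE; move: yY; rewrite mem_Ys => /andP[].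
  by move: H; rewrite /= nx (negbTE ny) /= !andbF.
have dA : [disjoint Ap & An].
  rewrite -setI_eq0; apply/eqP/setP => -[x y]; rewrite !inE /=; apply/negbTE/negP.
  case/andP => /and3P[a nx _] /and3P[_ ny _].
  rewrite isnegN in nx; have := arclt _ _ a.
  have {}ny : (y : nat) < c by []; lia.
rewrite cardsU (disjoint_setI0 dB) cards0 subn0 cardsU (disjoint_setI0 dA) cards0 subn0.
have cAp : #|Ap| = \sum_(k <- iota 0 c) isU k.
  rewrite -card_upper -(card_in_imset (f := snd) (D := mem Ap)); last first.
    move=> [x y] [x' y']; rewrite !inE /= => /and3P[a _ _] /and3P[a' _ _] e.
    rewrite e in a *; congr (_, _); apply/val_inj.
    by move: a a'; rewrite !arcs0E; apply: arc_uniql.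
  congr #|pred_of_set _|; apply/setP => y; rewrite !inE isnegN.
  apply/imsetP/andP => [[[x y'] ] | [cy]].
    rewrite inE /= isnegN => /and3P[a cx ly] ->; have xy := arclt _ _ a.
    have cy : c <= (y' : nat) by lia.
    split=> //; rewrite /isU.
    have -> : left_end (half w) (y' - c) = Some (true, x - c).
      by apply/(left_end_arc (label w) c); rewrite !subnKC // -arcs0E.
    by rewrite -labv.
  rewrite /isU; case e: (left_end _ _) => [[[] a]|] // hv.
  have /(left_end_arc (label w) c) := e.
  have cy' : c <= \val y by []; rewrite (subnKC cy') => A.
  have /arcP[ay _ _] := A; have an : c + a < 4 * n.
    by have := ltn_ord y; have {}ay : c + a < (y : nat) by []; lia.
  exists (Ordinal an, y) => //.
  by rewrite inE arcs0E A isnegN /= leq_addr labv.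
have cAn : #|An| = #|Ap|.
  pose sw (xy : pt n * pt n) := (mirror xy.2, mirror xy.1).
  have swK : involutive sw by move=> [x y]; rewrite /sw /mirror /= !rev_ordK.
  rewrite -(card_imset (mem Ap) (inv_inj swK)); congr #|pred_of_set _|.
  have arcsw (x y : pt n) : (x, y) \in arcs0 w -> (mirror y, mirror x) \in arcs0 w.
    rewrite !arcs0E => /(arc_mirror (ht_label_sym w)) H.
    have -> : (mirror y : nat) = c + c - y.+1 by rewrite /mirror /=; lia.
    have -> : (mirror x : nat) = c + c - x.+1 by rewrite /mirror /=; lia.
    by apply: H; have := ltn_ord y; lia.
  have negm (p : pt n) : isneg (mirror p) = ~~ isneg p.
    rewrite isnegN /isneg /mirror /=; have := ltn_ord p; lia.
  apply/setP => -[x y]; apply/idP/imsetP => [|[[x' y']]].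
    rewrite inE /= => /and3P[a ny ly]; exists (sw (x, y)); last by rewrite swK.
    rewrite inE /sw /= arcsw //= negm negbK ny lab_mirror /=.
    by have := arcor _ _ a; rewrite ny orbT ly => /(_ isT); case: lab.
  rewrite inE /= => /and3P[a nx ly] [-> ->].
  rewrite inE /= arcsw //= negm nx lab_mirror /=.
  by have := arcor _ _ a; rewrite nx ly => /(_ isT); case: lab.
have cB : #|B| = \sum_(k <- iota 0 c | k \in R w) half v k.
  rewrite card_imset => [|x y []//].
  rewrite big_mkcond /=; rewrite -[RHS](_ : \sum_(k <- iota 0 c) ((k \in R w) && half v k : nat) = _); last first.
    by apply: eq_bigr => k _; case: (k \in _).
  rewrite -(card_upper (fun k => (k \in R w) && half v k)).
  congr #|pred_of_set _|; apply/setP => y; rewrite !inE mem_Ys isnegN -andbA.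
  by case: leqP => //= cy; rewrite labv.
have [_ ev] := scan_end w.
(* Orientation gives both records of a linked pair the same label, and [isD] looks only at the
   second of them. *)
have cD : \sum_(k <- iota 0 c | k \in R w) half v k = (\sum_(k <- iota 0 c) isD k).*2.
  rewrite sum_records.
  have -> : \sum_(k <- iota 0 c) isD k = \sum_(k <- iota 0 c | k \in R w) isD k.
    rewrite [RHS]big_mkcond; apply: eq_big_seq => k; rewrite mem_iota add0n => /= kc.
    rewrite mem_records kc /= /isD /left_end -/(half w).
    case lk: (half w k); first by rewrite -[label _ _]/(half w k) lk.
    rewrite -[label _ _]/(half w k) lk /=.
    by case: scan => [[|a s] r].
  have [m sE] : exists m, size (R w) = m.*2.
    by exists (size (R w))./2; rewrite even_halfK.
  rewrite (sum_records w isD) sE.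
  rewrite (@sum_pairs (fun i => half v (nth 0 (R w) i))) => [|j jR].
    congr _.*2; apply: eq_bigr => i _.
    have iR : i < size (R w) by rewrite sE.
    rewrite /isD (left_end_record iR); case: (odd i); rewrite ?mul1n //.
  have jR' : j.*2.+1 < size (R w) by rewrite sE; lia.
  have := allP ori (nth 0 (R w) j.*2.+1); rewrite mem_iota /cup_ok.
  rewrite (left_end_record jR') /= odd_double /= => H.
  rewrite (eqP (H _)) //; have [] := records_nth jR'; lia.
rewrite cAn cAp cB cD addnn -doubleD -big_split; congr _.*2.
apply: eq_bigr => k _; rewrite /isU /isD /cup_cw.
by case: left_end => [[[] a]|] //=; rewrite addn0.
Qed.

Lemma graph_run (K : fieldType) (q : K) w v :
  (if oriented v w then q ^+ (cl v w %/ 2) else 0)%R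
  = exec q (@closing K) [::] (signs w) (signs v).
Proof.
rewrite run_signs -orientedE; case: ifP => // /clE ->.
by rewrite -muln2 mulnK.
Qed.

End Bridge.

(** * The Weyl group and its minimal coset representatives *)

Section Coxeter.
Import GroupScope.
Variable n : nat.
Hypothesis hn : 4 <= n.
Notation pos := ('I_n * bool)%type.
Implicit Types (i j : 'I_n) (w : gT n) (x y : pos).

Definition neg x : pos := (x.1, ~~ x.2).
(** Shifted to start at 1, so that negating a position negates its value and statements about
    generators become linear arithmetic. *)
Definition sv x : int := (if x.2 then - (x.1.+1)%:Z else (x.1.+1)%:Z)%R.

Lemma negK : involutive neg. Proof. by case=> a b; rewrite /neg /= negbK. Qed.
Lemma sv_neg x : sv (neg x) = (- sv x)%R.
Proof. by case: x => a []; rewrite /sv /= ?opprK. Qed.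
Lemma sv_inj : injective sv.
Proof.
move=> [a b] [a' b'] e; have [ea ->] : a = a' :> nat /\ b = b'.
  by move: e; rewrite /sv /=; case: b; case: b'; lia.
by congr (_, _); apply/val_inj.
Qed.
Lemma sv_neq0 x : sv x != 0%R.
Proof. by case: x => a []; rewrite /sv /=; lia. Qed.
Lemma sv_lt0 x : (sv x < 0)%R = x.2.
Proof. by case: x => a []; rewrite /sv /=; lia. Qed.

(* The simple reflection of index [i] exchanges [lo i] with [hi i]. *)
Definition lo i : pos := (insubd i (val i).-1, val i == 0).
Definition hi i : pos := (insubd i (if val i == 0 then 1%N else val i), false).

Lemma sv_lo i : sv (lo i) = (if val i == 0%N then (-1 : int) else Posz (val i))%R.
Proof.
rewrite /sv /lo /= val_insubd (leq_ltn_trans (leq_pred i)) ?ltn_ord //.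
by case: eqP => e; lia.
Qed.

Lemma sv_hi i : sv (hi i) = Posz (if val i == 0%N then 2 else (val i).+1).
Proof.
rewrite /sv /hi /= val_insubd; case: eqP => e; last by rewrite ltn_ord.
by have -> : 1%N < n by lia.
Qed.

Lemma lo_lt_hi i : (sv (lo i) < sv (hi i))%R.
Proof. by rewrite sv_lo sv_hi; case: eqP; lia. Qed.

Lemma genE i : gen i = tperm (lo i) (hi i) * tperm (neg (lo i)) (neg (hi i)).
Proof.
rewrite /gen /lo /hi /neg /=; case: eqP => e /=; last by [].
rewrite e.
set a := (_, false); set b := (_, true); set a' := (_, true); set b' := (_, false).
have d1 : a != a' by rewrite /a /a' xpair_eqE andbF.
have d2 : b != b' by rewrite /b /b' xpair_eqE andbF.
have lt1 : 1%N < n by lia.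
have d3 : a != b' by rewrite -(inj_eq sv_inj) /sv /a /b' /= !val_insubd lt1 /=; case: ifP; lia.
have d4 : a' != b by rewrite -(inj_eq sv_inj) /sv /a' /b /= !val_insubd lt1 /=; case: ifP; lia.
by rewrite conjgC tpermJ !tpermD // eq_sym.
Qed.

Lemma sv_gen i x : let L := sv (lo i) in let H := sv (hi i) in let s := sv x in
  sv (gen i x) = (if s == L then H else if s == H then L
    else if s == - L then - H else if s == - H then - L else s)%R.
Proof.
move=> L H s; rewrite genE permM {}/L {}/H {}/s.
have E y z : (sv y == sv z) = (y == z) by rewrite (inj_eq sv_inj).
rewrite -!sv_neg !E.
have nl : neg (lo i) != lo i.
  by rewrite -E sv_neg; move: (sv _) (sv_neq0 (lo i)) => z; lia.
have nh : neg (hi i) != hi i.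
  by rewrite -E sv_neg; move: (sv _) (sv_neq0 (hi i)) => z; lia.
have nlh : neg (lo i) != hi i.
  by rewrite -E sv_neg sv_lo sv_hi; case: (val i == 0); lia.
have nhl : neg (hi i) != lo i.
  by rewrite -E sv_neg sv_lo sv_hi; case: (val i == 0); lia.
case: (tpermP (lo i)) => [->|->|/eqP nxl /eqP nxh].
- by rewrite eqxx tpermD // eq_sym.
- rewrite eqxx; case: eqP => [->|_]; first by rewrite tpermD // eq_sym.
  by rewrite tpermD // eq_sym.
by rewrite (negbTE nxl) (negbTE nxh); case: tpermP => [->|->|/eqP/negbTE-> /eqP/negbTE->];
  rewrite ?eqxx //; case: eqP => [->|].
Qed.

Lemma genK i : gen i * gen i = 1.
Proof.
apply/permP => x; rewrite permM perm1; apply: sv_inj.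
rewrite sv_gen sv_gen sv_lo sv_hi; do !case: eqP; lia.
Qed.

Lemma genV i : (gen i)^-1 = gen i.
Proof. by apply/eqP; rewrite eq_invg_mul genK. Qed.

Lemma gen_neg i x : gen i (neg x) = neg (gen i x).
Proof.
apply: sv_inj; rewrite sv_gen !sv_neg sv_gen sv_lo sv_hi.
have := sv_neq0 x; do !case: eqP; lia.
Qed.

Lemma gen_lo i : gen i (lo i) = hi i.
Proof. by apply: sv_inj; rewrite sv_gen eqxx. Qed.

Lemma gen_hi i : gen i (hi i) = lo i.
Proof. by rewrite -gen_lo -permM genK perm1. Qed.

(** The values exchanged are neighbours, so only the two listed pairs are reversed. For [i = 0] the
    values moved are -2, -1, 1, 2, and opposite pairs are reversed as well, hence [y != neg x]. *)
Lemma gen_lt i x y : (sv x < sv y)%R -> y != neg x ->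
  (x, y) != (lo i, hi i) -> (x, y) != (neg (hi i), neg (lo i)) ->
  (sv (gen i x) < sv (gen i y))%R.
Proof.
rewrite !xpair_eqE -!(inj_eq sv_inj) !sv_neg !sv_gen sv_lo sv_hi.
have := sv_neq0 x; have := sv_neq0 y.
do !case: eqP; lia.
Qed.

Lemma W_neg w x : w \in W n -> w (neg x) = neg (w x).
Proof.
have negp : injective neg by exact: inv_inj negK.
have sub : W n \subset 'C[perm negp].
  rewrite gen_subG; apply/subsetP => _ /imsetP[i _ ->].
  apply/cent1P/permP => y; by rewrite !permM !permE gen_neg.
move/(subsetP sub)/cent1P/permP/(_ x).
by rewrite !permM !permE.
Qed.

Lemma gen_W i : gen i \in W n.
Proof. by apply/mem_gen/imset_f. Qed.

Lemma W_word w : w \in W n -> exists s : seq 'I_n, word_prod s = w.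
Proof.
case/gen_prodgP => k [f fP ->].
have /fin_all_exists[h hP] : forall a : 'I_k, exists i : 'I_n, f a = gen i.
  by move=> a; have /imsetP[i _ ->] := fP a; exists i.
exists [seq h a | a <- index_enum 'I_k]; rewrite /word_prod big_map.
by apply: eq_bigr => a _; rewrite hP.
Qed.

Lemma word_W (s : seq 'I_n) : word_prod s \in W n.
Proof. by rewrite /word_prod; apply: group_prod => i _; apply: gen_W. Qed.

Lemma word_rcons (s : seq 'I_n) i : word_prod (rcons s i) = word_prod s * gen i.
Proof. by rewrite /word_prod -cats1 big_cat big_seq1. Qed.

Lemma word_rev (s : seq 'I_n) : word_prod (rev s) = (word_prod s)^-1.
Proof.
elim: s => [|i s IH]; first by rewrite /word_prod big_nil invg1.
by rewrite rev_cons word_rcons IH {2}/word_prod big_cons invMg genV.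
Qed.

(** * Length as half the number of inversions *)

Definition inversions w : {set pos * pos} :=
  [set xy | [&& (sv xy.1 < sv xy.2)%R, xy.2 != neg xy.1 & (sv (w xy.2) < sv (w xy.1))%R]].
(** Twice the length on [W]: opposite pairs, which belong to no root of type D, are left out, and
    any other inversion [(x, y)] comes with [(neg y, neg x)]. *)
Definition dinv w := #|inversions w|.

(** Applying [gen i] to both entries matches the inversions of the two elements, except for the two
    pairs that [gen i] reverses; these are inversions of [gen i * w] only. *)
Lemma dinv_gen i w : w \in W n -> (sv (w (lo i)) < sv (w (hi i)))%R ->
  dinv (gen i * w) = (dinv w).+2.
Proof.
move=> wW lt; pose rts := [set (lo i, hi i); (neg (hi i), neg (lo i))].
have key u : inversions (gen i * u) :\: rts =
    [set (gen i xy.1, gen i xy.2) | xy in inversions u :\: rts].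
  have gg x : gen i (gen i x) = x by rewrite -permM genK perm1.
  have moved u' x y : (x, y) \in inversions (gen i * u') :\: rts ->
     (gen i x, gen i y) \in inversions u' :\: rts.
    rewrite !inE /= !permM => /andP[/norP[r1 r2] /and3P[xy nxy ->]].
    rewrite (gen_lt xy nxy r1 r2) !andbT -gen_neg.
    have -> : gen i y != gen i (neg x) by rewrite (inj_eq perm_inj).
    have gl : gen i (neg (lo i)) = neg (hi i) by rewrite gen_neg gen_lo.
    have gh : gen i (neg (hi i)) = neg (lo i) by rewrite gen_neg gen_hi.
    rewrite /= andbT; apply/norP; split; apply/eqP => -[ex ey]; move: xy;
      rewrite -(gg x) -(gg y) ex ey ?gen_lo ?gen_hi ?gl ?gh ?sv_neg;
      have := lo_lt_hi i; lia.
  apply/setP => -[x y]; apply/idP/imsetP => [H|[[x' y']]].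
    by exists (gen i x, gen i y); rewrite /= ?gg //; apply: moved.
  by move=> H [-> ->] /=; apply: moved; rewrite mulgA genK mul1g.
have keyC : #|inversions (gen i * w) :\: rts| = #|inversions w :\: rts|.
  rewrite key card_imset // => -[x y] [x' y'] [] /perm_inj -> /perm_inj -> //.
have nlo : (sv (w (neg (lo i))) = - sv (w (lo i)))%R by rewrite W_neg // sv_neg.
have nhi : (sv (w (neg (hi i))) = - sv (w (hi i)))%R by rewrite W_neg // sv_neg.
have cr : #|rts| = 2.
  rewrite cards2 xpair_eqE -!(inj_eq sv_inj) !sv_neg sv_lo sv_hi.
  by case: (val i == 0); lia.
have e1 : inversions w :&: rts = set0.
  apply/setP => -[x y]; rewrite !inE; apply/negbTE/negP => /=.
  case/andP => /and3P[_ _ H] /orP[]; rewrite xpair_eqE => /andP[/eqP ex /eqP ey].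
    by move: H; rewrite ex ey; lia.
  by move: H; rewrite ex ey nlo nhi; lia.
have e2 : inversions (gen i * w) :&: rts = rts.
  apply/setIidPr/subsetP => -[x y]; rewrite !inE /= !permM.
  have d : hi i != neg (lo i).
    by rewrite -(inj_eq sv_inj) sv_neg sv_lo sv_hi; case: (val i == 0); lia.
  case/orP => /eqP[-> ->].
    by rewrite gen_lo gen_hi lo_lt_hi d lt.
  rewrite !gen_neg gen_lo gen_hi negK nlo nhi !sv_neg ltrN2 lo_lt_hi ltrN2 lt andbT /=.
  by rewrite eq_sym.
rewrite /dinv -(cardsID rts (inversions (gen i * w))) -(cardsID rts (inversions w)).
by rewrite keyC e1 e2 cr cards0.
Qed.

Lemma W_genM i w : w \in W n -> gen i * w \in W n.
Proof. by move=> wW; rewrite groupM ?gen_W. Qed.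

Lemma dinv_gen_descent i w : w \in W n -> (sv (w (hi i)) < sv (w (lo i)))%R ->
  dinv w = (dinv (gen i * w)).+2.
Proof.
move=> wW lt; rewrite -(@dinv_gen i) ?W_genM //; first by rewrite mulgA genK mul1g.
by rewrite !permM gen_lo gen_hi.
Qed.

Lemma gen_ascent i w : w \in W n ->
  (sv (w (lo i)) < sv (w (hi i)))%R \/ (sv (w (hi i)) < sv (w (lo i)))%R.
Proof.
move=> wW; case: (ltgtP (sv (w (lo i))) (sv (w (hi i)))); [by left|by right|].
by move/sv_inj/perm_inj => e; have := lo_lt_hi i; rewrite e ltxx.
Qed.

(** * Sign sequences of group elements *)

Lemma alphaE w j b : w \in W n -> (w^-1 (j, b)).2 = b (+) ~~ alpha w j.
Proof.
move=> wW; rewrite /alpha valK negbK; case: b => //.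
by rewrite -[(j, true)]/(neg (j, false)) W_neg ?groupV.
Qed.

Lemma signs_nth w j : nth true (signs w) j = alpha w j.
Proof. by rewrite nth_mkseq. Qed.

Lemma eq_signs w w' : (forall j, alpha w j = alpha w' j) -> signs w = signs w'.
Proof.
move=> H; apply: (@eq_from_nth _ true); rewrite !size_mkseq // => k kn.
by rewrite !nth_mkseq //; apply: (H (Ordinal kn)).
Qed.

Definition increasing w := forall i, 0 < val i -> (sv (w (lo i)) < sv (w (hi i)))%R.

Lemma increasing_mono w (a b : 'I_n) : increasing w -> a < b ->
  (sv (w (a, false)) < sv (w (b, false)))%R.
Proof.
move=> inc; have [d] := ubnP b; elim: d b => // d IH b bd ab.
have b0 : 0 < val b by rewrite /= (leq_ltn_trans _ ab).
have := inc b b0; rewrite /lo /hi (gtn_eqF b0) => lt.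
have bE : insubd b (val b) = b by apply/val_inj; rewrite val_insubd ltn_ord.
rewrite bE in lt.
have pn : (val b).-1 < n by rewrite (leq_ltn_trans (leq_pred _)) ?ltn_ord.
have pE : insubd b (val b).-1 = Ordinal pn.
  by apply/val_inj; rewrite val_insubd pn.
rewrite pE in lt; case: (ltngtP a (Ordinal pn)) => /= H.
- apply: lt_trans lt; apply: IH => //=; lia.
- by move: b0 H ab => /=; lia.
- have -> : a = Ordinal pn by apply/val_inj.
  by [].
Qed.

(* Both one-line notations list increasingly the signed positions on which the common sign sequence is positive. *)
Lemma increasing_inj w w' : w \in W n -> w' \in W n ->
  increasing w -> increasing w' -> signs w = signs w' -> w = w'.
Proof.
move=> wW w'W iw iw' es.
pose vals (u : gT n) := [seq sv (u (j, false)) | j <- enum 'I_n].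
have srt u : increasing u -> sorted <%R (vals u).
  move=> iu; rewrite sorted_map.
  have : sorted ltn (map val (enum 'I_n)) by rewrite val_enum_ord iota_ltn_sorted.
  by rewrite sorted_map; apply: sub_sorted => a b /= ab; apply: increasing_mono.
have memv u z : u \in W n ->
    reflect (exists2 y, z = sv y & (u^-1 y).2 = false) (z \in vals u).
  move=> uW; apply: (iffP mapP) => [[j _ ->]|[y -> uy]].
    by exists (u (j, false)); rewrite ?permK.
  exists (u^-1 y).1; first by rewrite mem_enum.
  by rewrite -uy -surjective_pairing permKV.
have ea j : alpha w j = alpha w' j by rewrite -!signs_nth es.
have ev : vals w = vals w'.
  apply: lt_sorted_eq; [exact: srt | exact: srt |] => z.
  apply/memv/memv => // -[[j b] -> uy]; exists (j, b) => //; move: uy.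
    by rewrite !alphaE // ea.
  by rewrite !alphaE // ea.
have ep j : w (j, false) = w' (j, false).
  apply: sv_inj; have jn : j < size (enum 'I_n) by rewrite size_enum_ord.
  have := congr1 (fun s => nth (0%R : int) s j) ev.
  by rewrite /vals !(nth_map j) -?enumT // !nth_ord_enum.
apply/permP => -[j []]; last exact: ep.
by rewrite -[(j, true)]/(neg (j, false)) !W_neg // ep.
Qed.

Lemma alpha_gen i w (j : 'I_n) : w \in W n ->
  alpha (w * gen i) j = alpha w (gen i (j, false)).1 (+) (gen i (j, false)).2.
Proof.
move=> wW; have wgW : w * gen i \in W n by rewrite groupM ?gen_W.
have := alphaE j false wgW; rewrite invMg genV permM /=.
case: (gen i (j, false)) => k b; rewrite alphaE //= => /(congr1 negb).
by rewrite negbK => <-; case: b; case: (alpha w k).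
Qed.

Lemma alpha_gen_pos i w k : w \in W n -> 0 < val i -> k < n ->
  alpha (w * gen i) k
  = alpha w (if k == (val i).-1 then val i else if k == val i then (val i).-1 else k).
Proof.
move=> wW i0 kn; have := alpha_gen i (Ordinal kn) wW; rewrite /= => ->.
have := sv_gen i (Ordinal kn, false); case: (gen i _) => a b.
rewrite sv_lo sv_hi (gtn_eqF i0) /sv /= => H.
have [-> ->] : (a = (if k == i.-1 then i : nat else if k == i then i.-1 else k) :> nat)
    /\ b = false.
  by move: (ltn_ord a) i0 H; case: (b) => /=; do !case: ifP; lia.
by rewrite addbF.
Qed.

Lemma alpha_gen_zero i w k : w \in W n -> val i = 0 -> k < n ->
  alpha (w * gen i) k
  = if k == 0 then ~~ alpha w 1 else if k == 1%N then ~~ alpha w 0 else alpha w k.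
Proof.
move=> wW i0 kn; have := alpha_gen i (Ordinal kn) wW; rewrite /= => ->.
have := sv_gen i (Ordinal kn, false); case: (gen i _) => a b.
rewrite sv_lo sv_hi i0 /sv /= => H.
have [-> ->] : (a = (if k == 0 then 1 else if k == 1 then 0 else k)%N :> nat)
    /\ b = (k <= 1)%N.
  by move: H; case: (b) => /=; do !case: ifP; lia.
by case: k {kn H} => [|[|k]] /=; rewrite ?addbT ?addbF.
Qed.

Lemma signs_gen_pos i w u a b t : w \in W n -> 0 < val i -> (size u).+1 = i ->
  signs w = u ++ [:: a, b & t] -> signs (w * gen i) = u ++ [:: b, a & t].
Proof.
move=> wW i0 su es; have sz : n = size (u ++ [:: a, b & t]) by rewrite -es size_mkseq.
apply: (@eq_from_nth _ true); first by rewrite size_mkseq sz !size_cat.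
rewrite size_mkseq => k kn; rewrite nth_mkseq // alpha_gen_pos //.
have nthE (j : nat) : j < n -> alpha w j = nth true (u ++ [:: a, b & t]) j.
  by move=> jn; rewrite -es nth_mkseq.
have im : (val i).-1 = size u by rewrite /= -su.
have ii : val i = (size u).+1 by [].
set k' := if _ then _ else _.
have k'n : k' < n by rewrite /k'; have := ltn_ord i; do !case: ifP; lia.
rewrite (nthE _ k'n) /k' im ii !nth_cat; case: (ltngtP k (size u)) => h.
- by rewrite (ltn_eqF (leqW h)) h.
- case: eqP => e; first by rewrite e ltnn subnn subSnn.
  rewrite ltnNge (ltnW h) /=.
  by have [m ->] : exists m, k - size u = m.+2 by exists (k - size u).-2; lia.
- by rewrite h ltnNge leqnSn /= subSnn subnn.
Qed.

Lemma signs_gen_zero i w a b t : w \in W n -> val i = 0 ->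
  signs w = [:: a, b & t] -> signs (w * gen i) = [:: ~~ b, ~~ a & t].
Proof.
move=> wW i0 es; have sz : n = size [:: a, b & t] by rewrite -es size_mkseq.
apply: (@eq_from_nth _ true); first by rewrite size_mkseq.
rewrite size_mkseq => k kn; rewrite nth_mkseq // alpha_gen_zero //.
have nthE (j : nat) : j < n -> alpha w j = nth true [:: a, b & t] j.
  by move=> jn; rewrite -es nth_mkseq.
by rewrite !nthE //; try lia; case: k kn => [|[|k]].
Qed.

Lemma split_at (T : Type) (s : seq T) k : k.+1 < size s ->
  exists u a b t, s = u ++ [:: a, b & t] /\ size u = k.
Proof.
elim: k s => [|k IH] [|x s] //=; first by case: s => // y s _; exists [::], x, y, s.
by rewrite ltnS => /IH[u [a [b [t [-> <-]]]]]; exists (x :: u), a, b, t.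
Qed.

Lemma signs_gen i w : w \in W n ->
  (0 < val i /\ exists u a b t, [/\ (size u).+1 = i, signs w = u ++ [:: a, b & t]
     & signs (w * gen i) = u ++ [:: b, a & t]])
  \/ (val i = 0 /\ exists a b t, signs w = [:: a, b & t]
     /\ signs (w * gen i) = [:: ~~ b, ~~ a & t]).
Proof.
move=> wW; have sz : size (signs w) = n by rewrite size_mkseq.
case: (posnP (val i)) => i0; [right|left]; split=> //.
  have [|u [a [b [t [es /size0nil u0]]]]] := @split_at _ (signs w) 0.
    by rewrite sz; lia.
  rewrite u0 in es.
  by exists a, b, t; split=> //; apply: signs_gen_zero.
have [|u [a [b [t [es su]]]]] := @split_at _ (signs w) (val i).-1.
  by rewrite sz prednK // ltn_ord.
have su1 : (size u).+1 = i by rewrite su prednK.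
by exists u, a, b, t; split=> //; apply: signs_gen_pos es.
Qed.

Lemma par_signs w : w \in W n -> par (signs w) = false.
Proof.
case/W_word => s <-; elim/last_ind: s => [|s i IH].
  rewrite /word_prod big_nil /par (_ : count _ _ = 0) //.
  apply/eqP; rewrite eqn0Ngt -has_count; apply/hasPn => b /mapP[k].
  rewrite mem_iota /alpha => /= kn ->; case: insubP => //= j _ _.
  by rewrite invg1 perm1.
rewrite word_rcons; have [[_ [u [a [b [t [_ e ->]]]]]]|[_ [a [b [t [e ->]]]]]] :=
  signs_gen i (word_W s).
  by move: IH; rewrite e !par_cat !par_cons; case: (a); case: (b).
by move: IH; rewrite e !(par_cons _ t, par_cons) /=; case: a {e}; case: b => //=; case: (par t).
Qed.

Lemma increasing1 : increasing 1.
Proof. by move=> i _; rewrite !perm1 lo_lt_hi. Qed.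

Lemma signs1 : signs (1 : gT n) = nseq n true.
Proof.
apply: (@eq_from_nth _ true); rewrite size_mkseq ?size_nseq // => k kn.
rewrite nth_mkseq // nth_nseq kn /alpha; case: insubP => //= j _ _.
by rewrite invg1 perm1.
Qed.

Lemma par_all (s : seq bool) : all id s -> par s = false.
Proof. by elim: s => //= c s IH /andP[-> /IH]; rewrite par_cons. Qed.

(* [W] makes an even number of sign changes, so an element without descents makes none. *)
Lemma no_descent w : w \in W n ->
  (forall i, (sv (w (lo i)) < sv (w (hi i)))%R) -> w = 1.
Proof.
move=> wW asc; have inc : increasing w by move=> i _.
have n0 : 0 < n by lia.
have n1 : 1%N < n by lia.
(* The ascents at indices 1 and 0 bound the second entry below by the first entry and by its
   negative. *)
have pos1 : (0 < sv (w (Ordinal n1, false)))%R.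
  have := increasing_mono (a := Ordinal n0) (b := Ordinal n1) inc isT.
  have := asc (Ordinal n0); rewrite /lo /hi /=.
  have -> : insubd (Ordinal n0) 0 = Ordinal n0 by apply/val_inj; rewrite val_insubd n0.
  have -> : insubd (Ordinal n0) 1%N = Ordinal n1 by apply/val_inj; rewrite val_insubd n1.
  by rewrite -[(_, true)]/(neg (Ordinal n0, false)) W_neg // sv_neg; lia.
have posS j : 0 < val j -> (w (j, false)).2 = false.
  move=> j0; rewrite -sv_lt0; apply/negbTE; rewrite -leNgt.
  case: (ltngtP 1 (val j)) => jE; [|lia|].
    have := increasing_mono (a := Ordinal n1) (b := j) inc jE; lia.
  by have -> : j = Ordinal n1 by [apply/val_inj]; lia.
have aV j : alpha w^-1 j = ~~ (w (j, false)).2.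
  by have := @alphaE w^-1 j false; rewrite groupV invgK => ->; rewrite ?negbK.
have pos0 j : (w (j, false)).2 = false.
  case: (posnP (val j)) => [j0|]; last exact: posS.
  have := @par_signs w^-1; rewrite groupV => /(_ wW).
  have iE : iota 0 n = 0 :: iota 1%N n.-1 by rewrite -{1}(prednK n0).
  rewrite /signs /mkseq iE /= par_cons par_all; last first.
    apply/allP => b /mapP[k]; rewrite mem_iota => /andP[k0 kn] ->.
    have kn' : k < n by lia.
    by have := aV (Ordinal kn'); rewrite /= => ->; rewrite posS.
  have -> : 0 = j :> nat by [].
  by rewrite addbF aV negbK.
apply: increasing_inj => //; first exact: increasing1.
apply: eq_signs => j.
have := @alphaE 1 j false (group1 _); rewrite invg1 perm1 /= => /(congr1 negb).
rewrite negbK /= => <-.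
have := alphaE j false wW; case E: (w^-1 (j, false)) => [k b] /=.
have : w (k, b) = (j, false) by rewrite -E permKV.
case: b {E} => [|_ /(congr1 negb)]; last by rewrite negbK.
rewrite -[(k, true)]/(neg (k, false)) W_neg // => /(congr1 snd) /=.
by rewrite pos0.
Qed.

Lemma dinv1 : dinv 1 = 0.
Proof.
apply/eqP; rewrite cards_eq0; apply/eqP/setP => -[x y]; rewrite !inE /= !perm1.
by apply/negbTE/negP => /and3P[h _]; rewrite ltNge ltW.
Qed.

Lemma word_dinv (s : seq 'I_n) : dinv (word_prod s) <= (size s).*2.
Proof.
elim: s => [|i s IH]; first by rewrite /word_prod big_nil dinv1.
rewrite /word_prod big_cons -/(word_prod s) /= doubleS.
have [lt|gt] := gen_ascent i (word_W s); first by rewrite dinv_gen ?word_W ?ltnS.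
by rewrite (dinv_gen_descent (word_W s) gt) in IH; lia.
Qed.

Lemma dinv_word w : w \in W n ->
  exists s : seq 'I_n, word_prod s = w /\ (size s).*2 = dinv w.
Proof.
have [d] := ubnP (dinv w); elim: d w => // d IH w wd wW.
have [/existsP[i lt]|no] := boolP [exists i : 'I_n, (sv (w (hi i)) < sv (w (lo i)))%R].
  have e := dinv_gen_descent wW lt.
  have [|s [sw ss]] := IH (gen i * w) _ (W_genM i wW); first by lia.
  exists (i :: s); rewrite /word_prod big_cons -/(word_prod s) sw mulgA genK mul1g.
  by split=> //; rewrite /= doubleS ss e.
have w1 : w = 1.
  apply: no_descent => // i; have [//|gt] := gen_ascent i wW.
  by case/existsP: no; exists i.
by exists [::]; rewrite w1 dinv1 /word_prod big_nil.
Qed.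

(** [len] searches only up to the order [(2n)!] of the ambient symmetric group, while inversions
    bound reduced words by [(2n)^2]; this inequality keeps them within the search. *)
Lemma leq_sqr_fact m : 4 <= m -> m * m <= m`!.
Proof.
case: m => [|[|[|m]]] // m1; rewrite !factS; have := fact_gt0 m; nia.
Qed.

Lemma len_dinv w : w \in W n -> (len w).*2 = dinv w.
Proof.
move=> wW; have [s [sw ss]] := dinv_word wW.
have bound : size s < #|[set: gT n]|.+1.
  have : dinv w <= #|{: pos * pos}| by apply: max_card.
  have -> : #|[set: gT n]| = (n * 2)`!.
    have <- : #|{: pos}| = (n * 2)%N by rewrite card_prod card_ord card_bool.
    rewrite -cardsT -card_perm; apply: eq_card => p; rewrite !inE.
    by apply/esym/subsetP => x _; rewrite inE.
  rewrite !card_prod card_ord card_bool -ss.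
  have := @leq_sqr_fact (n * 2); lia.
have P0 : [exists t : (size s).-tuple 'I_n, word_prod t == w].
  by apply/existsP; exists (in_tuple s); rewrite /= sw.
have le : len w <= size s.
  rewrite leqNgt; apply/negP => lt; have := before_find 0 lt.
  by rewrite nth_iota // add0n P0.
have hs : has (fun k => [exists t : k.-tuple 'I_n, word_prod t == w])
    (iota 0 (#|[set: gT n]|.+1)).
  by apply/hasP; exists (size s) => //; rewrite mem_iota.
have := nth_find 0 hs; rewrite -/(len w) nth_iota; last by rewrite (leq_ltn_trans le).
rewrite add0n => /existsP[t /eqP tw]; have := word_dinv t; rewrite tw size_tuple.
by rewrite -ss leq_double => ge; congr _.*2; apply/eqP; rewrite eqn_leq le ge.
Qed.

Lemma ltn_len_gen i w : w \in W n ->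
  (len w < len (gen i * w)) = (sv (w (lo i)) < sv (w (hi i)))%R.
Proof.
move=> wW; rewrite -ltn_double !len_dinv ?W_genM //.
have [lt|gt] := gen_ascent i wW; first by rewrite lt dinv_gen // leqnSn.
by rewrite (dinv_gen_descent wW gt) ltNge (ltW gt) ltnNge leqW.
Qed.

Lemma WpP w : reflect (w \in W n /\ increasing w) (w \in Wp n).
Proof.
rewrite inE; apply: (iffP andP) => [[wW /forallP H]|[wW inc]]; split=> //.
  by move=> i i0; rewrite -ltn_len_gen //; apply: (implyP (H i)).
by apply/forallP => i; apply/implyP => i0; rewrite ltn_len_gen //; apply: inc.
Qed.

Lemma Wp_W w : w \in Wp n -> w \in W n. Proof. by case/WpP. Qed.

Lemma len_word (s : seq 'I_n) : len (word_prod s) <= size s.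
Proof. by rewrite -leq_double len_dinv ?word_W // word_dinv. Qed.

Lemma word_len w : w \in W n ->
  exists s : seq 'I_n, word_prod s = w /\ size s = len w.
Proof.
move=> wW; have [s [sw ss]] := dinv_word wW; exists s; split=> //.
by apply: double_inj; rewrite ss len_dinv.
Qed.

Lemma len_inv w : w \in W n -> len w^-1 = len w.
Proof.
have le u : u \in W n -> len u^-1 <= len u.
  by case/word_len => s [<- <-]; rewrite -word_rev (leq_trans (len_word _)) ?size_rev.
move=> wW; apply/eqP; rewrite eqn_leq le //.
by rewrite -{1}[w]invgK le // groupV.
Qed.

Lemma rw_word w : w \in W n -> word_prod (rw w) = w /\ size (rw w) = len w.
Proof.
move=> wW; rewrite /rw; case: pickP => [t /eqP tw|no]; first by rewrite size_tuple.
have [s [sw ss]] := word_len wW.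
by have := no (tcast ss (in_tuple s)); rewrite val_tcast /= sw eqxx.
Qed.

Lemma len1 : len (1 : gT n) = 0.
Proof. by apply/double_inj; rewrite len_dinv ?group1 // dinv1. Qed.

Lemma len_gen1 i : len (gen i) = 1%N.
Proof.
apply/double_inj; rewrite len_dinv ?gen_W // -[gen i]mulg1 dinv_gen ?dinv1 //.
by rewrite !perm1 lo_lt_hi.
Qed.

Lemma Wp1 : 1 \in Wp n.
Proof. by apply/WpP; split=> //; exact: increasing1. Qed.

Lemma Wp_inj w w' : w \in Wp n -> w' \in Wp n -> signs w = signs w' -> w = w'.
Proof. by move=> /WpP[? ?] /WpP[? ?]; apply: increasing_inj. Qed.

(** * Cosets of the parabolic subgroup *)

Lemma Wpg_sign w x : w \in Wpg n -> (w x).2 = x.2.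
Proof.
pose A := [set p : gT n | [forall y : pos, (p y).2 == y.2]].
have gA : group_set A.
  apply/group_setP; split=> [|p p']; first by rewrite inE; apply/forallP => y; rewrite perm1.
  rewrite !inE => /forallP h /forallP h'; apply/forallP => y; rewrite permM.
  by rewrite (eqP (h' _)).
have sub : Wpg n \subset Group gA.
  rewrite gen_subG; apply/subsetP => _ /imsetP[i i0 ->]; rewrite !inE.
  rewrite inE in i0; apply/forallP => y; apply/eqP.
  rewrite -!sv_lt0 sv_gen sv_lo sv_hi (gtn_eqF i0).
  by have := sv_neq0 y; do !case: eqP; lia.
by move/(subsetP sub); rewrite inE => /forallP/(_ x)/eqP.
Qed.

Lemma Wpg_signs w w' : w \in Wpg n -> signs (w * w') = signs w'.
Proof.
move=> wP; apply: eq_signs => j; rewrite /alpha valK invMg permM.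
by rewrite Wpg_sign ?groupV.
Qed.

Lemma signs_sign w w' x : w \in W n -> w' \in W n -> signs w = signs w' ->
  (w^-1 x).2 = (w'^-1 x).2.
Proof.
by case: x => j b wW w'W es; rewrite !alphaE // -!signs_nth es.
Qed.

Lemma gen_fix i x : x != lo i -> x != hi i -> x != neg (lo i) -> x != neg (hi i) ->
  gen i x = x.
Proof.
rewrite -!(inj_eq sv_inj) !sv_neg => h1 h2 h3 h4; apply: sv_inj.
by rewrite sv_gen (negbTE h1) (negbTE h2) (negbTE h3) (negbTE h4).
Qed.

Lemma signs_gen_eq i w : w \in W n ->
  (signs (w * gen i) == signs w) = ((w^-1 (lo i)).2 == (w^-1 (hi i)).2).
Proof.
move=> wW; have wgW : w * gen i \in W n by rewrite groupM ?gen_W.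
have nW x : w^-1 (neg x) = neg (w^-1 x) by rewrite W_neg ?groupV.
apply/eqP/eqP => [es|e].
  by rewrite -(signs_sign _ wgW wW es) invMg genV permM gen_lo.
apply: eq_signs => j; have H x : ((w * gen i)^-1 x).2 = (w^-1 x).2.
  rewrite invMg genV permM.
  have [->|h1] := eqVneq x (lo i); first by rewrite gen_lo.
  have [->|h2] := eqVneq x (hi i); first by rewrite gen_hi.
  have [->|h3] := eqVneq x (neg (lo i)); first by rewrite gen_neg gen_lo !nW /= e.
  have [->|h4] := eqVneq x (neg (hi i)); first by rewrite gen_neg gen_hi !nW /= e.
  by rewrite gen_fix.
by have := H (j, false); rewrite !alphaE //= => /negb_inj.
Qed.

(** By [gen_lt], only an ascent of [w] that is one of the two exceptional pairs could be lost. Then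
    [lo i] and [hi i] have preimages of equal sign, and the sign sequence would not change. *)
Lemma gen_increasing i w : w \in Wp n -> signs (w * gen i) != signs w ->
  w * gen i \in Wp n.
Proof.
move=> wWp; have wW := Wp_W wWp; have [_ inc] := WpP _ wWp.
rewrite signs_gen_eq // => sne.
have wgW : w * gen i \in W n by rewrite groupM ?gen_W.
have nW x : w^-1 (neg x) = neg (w^-1 x) by rewrite W_neg ?groupV.
apply/WpP; split=> // j j0; rewrite !permM.
have lt := inc j j0.
have nn : w (hi j) != neg (w (lo j)).
  rewrite -W_neg // (inj_eq perm_inj) -(inj_eq sv_inj) sv_neg sv_lo sv_hi.
  by rewrite (gtn_eqF j0); lia.
apply: gen_lt => //; apply: contra sne => /eqP[el eh]; apply/eqP.
  by rewrite -el -eh !permK /= (gtn_eqF j0).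
rewrite -[lo i]negK -[hi i]negK -el -eh !nW !permK /=.
by rewrite (gtn_eqF j0).
Qed.

(** The two values exchanged have preimages of the same sign. Since [w] is increasing, these are
    neighbouring positions, so conjugating [gen i] by [w] gives a simple reflection of [W_p]. *)
Lemma gen_conj i w : w \in Wp n -> signs (w * gen i) = signs w ->
  exists j, 0 < val j /\ w * gen i = gen j * w.
Proof.
move=> wWp /eqP; have wW := Wp_W wWp; have [_ inc] := WpP _ wWp.
rewrite signs_gen_eq // => /eqP same.
have nW x : w^-1 (neg x) = neg (w^-1 x) by rewrite W_neg ?groupV.
(* Negating the pair if necessary makes both preimages unsigned. A value strictly between, which
   occurs for [i = 0], is the negative of [l] or [h], so its preimage is signed and cannot separate
   them. *)
have [l [h [gE al bl lh mid]]] : exists l h, [/\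
    gen i = tperm l h * tperm (neg l) (neg h), (w^-1 l).2 = false,
    (w^-1 h).2 = false, (sv l < sv h)%R &
    forall x, (sv l < sv x)%R -> (sv x < sv h)%R -> x = neg l \/ x = neg h].
  have mid x : (sv (lo i) < sv x)%R -> (sv x < sv (hi i))%R -> x = neg (lo i).
    move=> h1 h2; apply: sv_inj; move: h1 h2 (sv_neq0 x).
    by rewrite sv_neg sv_lo sv_hi; case: (val i == 0); lia.
  case e: (w^-1 (lo i)).2; last first.
    exists (lo i), (hi i); split=> //; first exact: genE; first by rewrite -same.
      exact: lo_lt_hi.
    by move=> x h1 h2; left; apply: mid.
  exists (neg (hi i)), (neg (lo i)); split.
  - by rewrite -genV genE invMg !tpermV !negK; congr (_ * _); exact: tpermC.
  - by rewrite nW /= -same e.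
  - by rewrite nW /= e.
  - by rewrite !sv_neg; have := lo_lt_hi i; lia.
  - move=> x; rewrite !sv_neg !negK => h1 h2; right; rewrite -[x]negK (mid (neg x)) ?negK //.
      by rewrite sv_neg; lia.
    by rewrite sv_neg; lia.
set a := w^-1 l in al; set b := w^-1 h in bl.
have wa : w a = l by rewrite /a permKV.
have wb : w b = h by rewrite /b permKV.
have aE : a = (a.1, false) by rewrite {1}[a]surjective_pairing al.
have bE : b = (b.1, false) by rewrite {1}[b]surjective_pairing bl.
have ab : a.1 < b.1.
  case: (ltngtP a.1 b.1) => // [ba|e].
    by have := increasing_mono inc ba; rewrite -aE -bE wa wb ltNge (ltW lh).
  by move: lh; rewrite -wa -wb aE bE (val_inj e) ltxx.
have b1 : b.1 = a.1.+1 :> nat.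
  apply/eqP; rewrite eqn_leq ab andbT leqNgt; apply/negP => lt.
  have zn : a.1.+1 < n by apply: leq_trans lt _; apply/ltnW/ltn_ord.
  pose z := Ordinal zn.
  have az := @increasing_mono w a.1 z inc (leqnn _).
  have zb := @increasing_mono w z b.1 inc lt.
  rewrite -aE wa in az; rewrite -bE wb in zb.
  by case: (mid _ az zb) => e; have := congr1 (fun x => (w^-1 x).2) e;
    rewrite permK nW /= ?al ?bl.
have b0 : 0 < val b.1 by rewrite /= b1.
exists b.1; split=> //; apply: (mulIg w^-1); rewrite mulgK.
have -> : w * gen i * w^-1 = gen i ^ w^-1 by rewrite conjgE invgK mulgA.
rewrite gE conjMg !tpermJ !nW -/a -/b genE.
have -> : lo b.1 = a.
  rewrite aE /lo (gtn_eqF b0); congr (_, _); apply/val_inj.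
  rewrite val_insubd /= (leq_ltn_trans (leq_pred _)) ?ltn_ord // b1 //.
have -> : hi b.1 = b.
  rewrite [RHS]bE /hi (gtn_eqF b0); congr (_, _); apply/val_inj.
  by rewrite val_insubd ltn_ord.
by [].
Qed.

Lemma ltn_len_genr i w : w \in W n ->
  (len w < len (w * gen i)) = (sv (w^-1%g (lo i)) < sv (w^-1%g (hi i)))%R.
Proof.
move=> wW; rewrite -(len_inv wW) -(@len_inv (w * gen i)) ?groupM ?gen_W //.
by rewrite invMg genV ltn_len_gen // groupV.
Qed.

Lemma signs_gen_neq i w : w \in W n -> signs (w * gen i) != signs w ->
  (len (w * gen i) < len w) = ~~ (w^-1 (lo i)).2.
Proof.
move=> wW; rewrite signs_gen_eq // => ne.
have wgW : w * gen i \in W n by rewrite groupM ?gen_W.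
have := ltn_len_genr i wgW; rewrite -mulgA genK mulg1 => ->.
rewrite invMg genV !permM gen_lo gen_hi.
move: ne; rewrite -!sv_lt0; have := sv_neq0 (w^-1 (lo i)); have := sv_neq0 (w^-1 (hi i)).
move: (sv (w^-1 (lo i))) (sv (w^-1 (hi i))) => a b.
by case: (ltP a 0%R); case: (ltP b 0%R); lia.
Qed.

Lemma neg_lo_signs i w : w \in W n ->
  (w^-1 (lo i)).2 = (val i == 0) (+) ~~ alpha w (val i).-1.
Proof.
move=> wW; rewrite /lo alphaE // val_insubd.
by rewrite (leq_ltn_trans (leq_pred _)) ?ltn_ord.
Qed.

(** A factor [+ -] arises from [- +] by a swap, and leading [- -] from [+ +] by [s_0]; each has a
    predecessor of smaller [lexval]. What is left is all [+], or a single leading [-], which parity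
    excludes. *)
Lemma signs_surj s : size s = n -> par s = false ->
  exists2 w, w \in Wp n & signs w = s.
Proof.
have n0 : 0 < n by lia.
have [d] := ubnP (lexval s); elim: d s => // d IH s sd sn ps.
have form (r : seq bool) : (exists k m, r = nseq k false ++ nseq m true) \/
    exists u t, r = u ++ [:: true, false & t].
  elim: r => [|c r [[k [m ->]]|[u [t ->]]]]; first by left; exists 0, 0.
    case: c; last by left; exists k.+1, m.
    case: k => [|k]; first by left; exists 0, m.+1.
    by right; exists [::], (nseq k false ++ nseq m true).
  by right; exists (c :: u), t.
have lexcat u r r' : lexval r < lexval r' -> lexval (u ++ r) < lexval (u ++ r').
  by elim: u => //= c u IHu /IHu; lia.
have step s' i : lexval s' < lexval s -> size s' = n -> par s' = false ->
    (forall w, w \in W n -> signs w = s' -> signs (w * gen i) = s) ->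
    exists2 w, w \in Wp n & signs w = s.
  move=> lt ss' ps' H; have [|w wWp ws] := IH s' _ ss' ps'; first lia.
  have e := H w (Wp_W wWp) ws.
  exists (w * gen i) => //; apply: gen_increasing => //.
  by rewrite e ws; apply/eqP => es; rewrite es ltnn in lt.
have [[k [m sE]]|[u [t sE]]] := form s; last first.
  have un : (size u).+1 < n by rewrite -sn sE size_cat /=; lia.
  apply: (@step (u ++ [:: false, true & t]) (Ordinal un)).
  - by rewrite sE; apply: lexcat => /=; lia.
  - by rewrite -sn sE !size_cat.
  - by rewrite -[RHS]ps sE !par_cat !par_cons.
  - by move=> w wW ws; rewrite sE; apply: signs_gen_pos ws.
case: k sE => [|[|k]] sE.
- exists 1; first exact: Wp1.
  by rewrite signs1 sE /= -sn sE /= size_nseq.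
- move: ps; rewrite sE par_cons par_all //.
  by apply/allP => b /nseqP[->].
apply: (@step [:: true, true & nseq k false ++ nseq m true] (Ordinal n0)).
- by rewrite sE /=; lia.
- by rewrite -sn sE.
- by rewrite -[RHS]ps sE !par_cons /=; case: (par _).
- by move=> w wW ws; rewrite sE; apply: signs_gen_zero ws.
Qed.

Lemma Wpg_Wp_eq w w' : w \in Wp n -> w' \in Wp n -> w * w'^-1 \in Wpg n -> w = w'.
Proof.
move=> wW w'W h; apply: Wp_inj => //.
by rewrite -[in LHS](mulgKV w' w) Wpg_signs.
Qed.

Lemma piv_Wp w (y : gT n) : w \in Wp n -> piv w y = (y == w)%:R%R.
Proof.
move=> wWp; rewrite ffunE; have [->|ne] := eqVneq y w.
  by rewrite wWp mulgV group1 len1 expr0.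
by case: ifP => // /andP[yWp h]; rewrite (Wpg_Wp_eq wWp yWp h) eqxx in ne.
Qed.

Lemma piv_gen i w (y : gT n) : w \in Wp n -> signs (w * gen i) = signs w ->
  piv (w * gen i) y = (if y == w then - q else 0)%R.
Proof.
move=> wWp es; have [j [j0 e]] := gen_conj wWp es.
have gP : gen j \in Wpg n by apply/mem_gen/imset_f; rewrite inE.
rewrite ffunE e; have [->|ne] := eqVneq y w.
  by rewrite wWp mulgK gP len_gen1 expr1.
case: ifP => // /andP[yWp h]; rewrite -mulgA groupMl // in h.
by rewrite (Wpg_Wp_eq wWp yWp h) eqxx in ne.
Qed.

Lemma len_gen_same i w : w \in Wp n -> signs (w * gen i) = signs w ->
  (len (w * gen i) < len w) = false.
Proof.
move=> wWp es; have [j [j0 ->]] := gen_conj wWp es.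
have [wW inc] := WpP _ wWp; apply/negbTE; rewrite -leqNgt ltnW // ltn_len_gen //.
exact: inc.
Qed.

(* Left descents of a prefix of a reduced word are left descents of the whole word. *)
Lemma Wp_prefix (s : seq 'I_n) i : word_prod (rcons s i) \in Wp n ->
  len (word_prod (rcons s i)) = (size s).+1 ->
  [/\ word_prod s \in Wp n, len (word_prod s) = size s &
      len (word_prod s) < len (word_prod s * gen i)].
Proof.
move=> /WpP[_ inc]; rewrite word_rcons => ls.
have lg w : w \in W n -> len (w * gen i) <= (len w).+1.
  case/word_len => t [<- <-]; rewrite -word_rcons.
  by apply: leq_trans (len_word _) _; rewrite size_rcons.
have l1 : len (word_prod s) = size s.
  by apply/eqP; rewrite eqn_leq len_word -ltnS -ls lg ?word_W.
split=> //; last by rewrite ls l1.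
apply/WpP; split; first exact: word_W.
move=> j j0; rewrite -ltn_len_gen ?word_W // ltnNge l1; apply/negP => H.
have := inc j j0; rewrite word_rcons -ltn_len_gen; last by rewrite groupM ?gen_W ?word_W.
rewrite mulgA ls ltnNge (leq_trans (lg _ _)) ?W_genM ?word_W //.
Qed.

End Coxeter.

(** * The bar involution and the Kazhdan-Lusztig basis *)

Local Open Scope ring_scope.

Lemma clear_denominators (K : fieldType) (a b x y : K) : x != 0 -> y != 0 ->
  (a / y + b / x) * (x * y) = a * x + b * y.
Proof. by move=> x0 y0; field; rewrite x0 y0. Qed.

(** * Laurent polynomials inside the field of fractions *)

Section Laurent.

Definition ev (p : {poly int}) (x : F) : F := (map_poly intr p).[x].

Lemma evD p p' x : ev (p + p') x = ev p x + ev p' x.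
Proof. by rewrite /ev rmorphD hornerD. Qed.
Lemma evM p p' x : ev (p * p') x = ev p x * ev p' x.
Proof. by rewrite /ev rmorphM hornerM. Qed.
Lemma evN p x : ev (- p) x = - ev p x.
Proof. by rewrite /ev rmorphN hornerN. Qed.
Lemma ev1 x : ev 1 x = 1.
Proof. by rewrite /ev rmorph1 hornerE. Qed.
Lemma ev0 x : ev 0 x = 0.
Proof. by rewrite /ev rmorph0 hornerE. Qed.
Lemma evXn k x : ev 'X^k x = x ^+ k.
Proof. by rewrite /ev map_polyXn hornerXn. Qed.

Lemma evZ c p x : ev (c *: p) x = c%:~R * ev p x.
Proof. by rewrite /ev map_polyZ hornerZ. Qed.
Lemma ev_sum (I : Type) (r : seq I) (f : I -> {poly int}) x :
  ev (\sum_(i <- r) f i) x = \sum_(i <- r) ev (f i) x.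
Proof. by rewrite /ev rmorph_sum horner_sum. Qed.

Lemma ev_q p : ev p q = tofrac p.
Proof.
elim/poly_ind: p => [|p c IH]; first by rewrite ev0 rmorph0.
rewrite evD evM IH rmorphD rmorphM -['X]expr1 evXn !expr1; congr (_ + _).
have -> : c%:P = c%:~R :> {poly int} by rewrite -[c in LHS]intz rmorph_int.
by rewrite /ev !rmorph_int hornerMz hornerC.
Qed.

Lemma ev_inj p p' : ev p q = ev p' q -> p = p'.
Proof. by rewrite !ev_q => /eqP; rewrite tofrac_eq => /eqP. Qed.

Lemma q_neq0 : q != 0.
Proof. by rewrite /q tofrac_eq0 polyX_eq0. Qed.

(* [x] is a Laurent polynomial in [q], and [y] its image under [q |-> q^-1]. *)
Definition bar_rel (x y : F) : Prop := exists r : LR, x = valL r /\ y = barL r.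

Lemma valLE p k : valL (p, k) = ev p q / q ^+ k. Proof. by []. Qed.
Lemma barLE p k : barL (p, k) = ev p q^-1 * q ^+ k. Proof. by []. Qed.

Lemma bar_rel_poly p : bar_rel (ev p q) (ev p q^-1).
Proof. by exists (p, 0%N); rewrite valLE barLE expr0 divr1 mulr1. Qed.

Lemma bar_rel0 : bar_rel 0 0.
Proof. by have := bar_rel_poly 0; rewrite !ev0. Qed.

Lemma bar_rel1 : bar_rel 1 1.
Proof. by have := bar_rel_poly 1; rewrite !ev1. Qed.

Lemma bar_relq : bar_rel q q^-1.
Proof. by have := bar_rel_poly 'X^1; rewrite !evXn !expr1. Qed.

Lemma bar_relqV : bar_rel q^-1 q.
Proof. by exists (1, 1%N); rewrite valLE barLE !ev1 expr1 !mul1r. Qed.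

Lemma bar_relN x y : bar_rel x y -> bar_rel (- x) (- y).
Proof.
case=> -[p k] [-> ->]; exists (- p, k).
by rewrite !valLE !barLE !evN !mulNr.
Qed.

Lemma bar_relM x y x' y' : bar_rel x y -> bar_rel x' y' -> bar_rel (x * x') (y * y').
Proof.
case=> -[p k] [-> ->] [[p' k'] [-> ->]]; exists (p * p', (k + k')%N).
rewrite !valLE !barLE !evM !exprD invfM; split; first by rewrite mulrACA.
by rewrite mulrACA.
Qed.

Lemma bar_relD x y x' y' : bar_rel x y -> bar_rel x' y' -> bar_rel (x + x') (y + y').
Proof.
case=> -[p k] [-> ->] [[p' k'] [-> ->]].
exists (p * 'X^k' + p' * 'X^k, (k + k')%N).
have qk j : q ^+ j != 0 by rewrite expf_neq0 ?q_neq0.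
rewrite !valLE !barLE !evD !evM !evXn !exprD !exprVn; split; first by rewrite addf_div.
by rewrite clear_denominators.
Qed.

(** Clearing denominators turns an equality of two representations into an identity of polynomials,
    which can be evaluated at [q^-1]. *)
Lemma bar_rel_fun x y y' : bar_rel x y -> bar_rel x y' -> y = y'.
Proof.
case=> -[p k] [-> ->] [[p' k'] []]; rewrite !valLE !barLE.
have qk j : q ^+ j != 0 by rewrite expf_neq0 ?q_neq0.
move/eqP; rewrite eqr_div // => /eqP; rewrite -!(evXn _ q) -!evM => /ev_inj e ->.
have := congr1 (fun r => ev r q^-1) e; rewrite !evM !evXn !exprVn => /eqP.
by rewrite eqr_div // => /eqP.
Qed.

Lemma in_qZqB x y : in_qZq x -> in_qZq y -> in_qZq (x - y).
Proof.
case=> p [p0 ->] [p' [p0' ->]]; exists (p - p'); split.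
  by rewrite coefB p0 p0' subr0.
by rewrite -!/(ev _ _) evD evN.
Qed.

Lemma in_qZq0 : in_qZq 0.
Proof. by exists 0; rewrite coef0 -/(ev _ _) ev0. Qed.

Lemma in_qZqXn k : in_qZq (q ^+ k.+1).
Proof. by exists 'X^(k.+1); rewrite coefXn -/(ev _ _) evXn. Qed.

(* A bar-invariant element of q Z[q] vanishes: compare degrees in [P(q) = P(q^-1)]. *)
Lemma bar_fixed_qZq x : in_qZq x -> bar_rel x x -> x = 0.
Proof.
case=> P [P0 ->]; rewrite -/(ev _ _) => fx.
have e := bar_rel_fun fx (bar_rel_poly P).
suff -> : P = 0 by rewrite ev0.
set d := size P.
(* The polynomial [q^d P(q^-1)], of degree at most [d]; multiplying [P], which has no constant term,
   by the same power leaves only degrees above [d]. *)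
pose R := \sum_(i < d) P`_i *: 'X^(d - i).
have PE : P = \sum_(i < d) P`_i *: 'X^i by rewrite -{1}[P]coefK poly_def.
have eR : P * 'X^d = R.
  apply: ev_inj; rewrite evM evXn e [in LHS]PE !ev_sum mulr_suml.
  apply: eq_bigr => i _; rewrite !evZ !evXn exprVn -mulrA; congr (_ * _).
  have -> : q ^+ d = q ^+ (d - i) * q ^+ i by rewrite -exprD subnK // ltnW.
  by rewrite mulrC mulfK // expf_neq0 // q_neq0.
apply/polyP => j; rewrite coef0; case: j => [//|j].
case: (ltnP j.+1 d) => jd; last by rewrite nth_default.
have := congr1 (fun p : {poly int} => p`_(j.+1 + d)) eR.
rewrite coefMXn ltnNge leq_addl /= addnK => ->; rewrite coef_sum big1 // => i _.
rewrite coefZ coefXn; case: eqP => [h|_]; last by rewrite mulr0.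
by have := ltn_ord i; lia.
Qed.

End Laurent.

(** * The module action on diagram vectors *)

Section Hecke.
Variable n : nat.
Hypothesis hn : (4 <= n)%N.
Implicit Types (w v x y : gT n) (i : 'I_n).

Definition graph x v : F := exec q (@closing F) [::] (signs x) (signs v).

Definition actC i (m : vecN n) v : F := actS i m v + q * m v.

(** Only [w = v] and [w = v * gen i] contribute at [v]. If the signs are fixed, [gen_conj] moves the
    generator to the left into [W_p], where it acts by [- q]. *)
Lemma actSE i (m : vecN n) v : v \in Wp n -> actS i m v =
  if signs (v * gen i)%g == signs v then - q * m v
  else m (v * gen i)%g + (if (len (v * gen i)%g < len v)%N then (q^-1 - q) * m v else 0).
Proof.
move=> vWp; rewrite ffunE (bigD1 v) //= (piv_Wp hn _ vWp) eqxx mulr1.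
have gg w : (w * gen i * gen i = w)%g by rewrite -mulgA genK // mulg1.
have other w : w \in Wp n -> w != v -> v != (w * gen i)%g ->
    m w * (piv (w * gen i)%g v +
      (if (len (w * gen i)%g < len w)%N then (q^-1 - q) * piv w v else 0)) = 0.
  move=> wWp wv vwg; rewrite (piv_Wp hn v wWp) eq_sym (negbTE wv) mulr0 if_same addr0.
  case: (eqVneq (signs (w * gen i)%g) (signs w)) => [ew|nw].
    by rewrite piv_gen // eq_sym (negbTE wv) mulr0.
  by rewrite (piv_Wp hn v (gen_increasing hn wWp nw)) (negbTE vwg) mulr0.
case: eqP => [es|/eqP ne].
  rewrite (piv_gen hn v vWp es) eqxx (len_gen_same hn vWp es) addr0.
  rewrite big1 => [|w /andP[wWp wv]]; first by rewrite addr0 mulrC.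
  apply: other => //; apply: contra wv => /eqP vE; apply/eqP.
  by apply: (Wp_inj hn wWp vWp); rewrite -es vE gg.
have vgWp : (v * gen i)%g \in Wp n by apply: gen_increasing.
have vgv : (v * gen i)%g != v by apply: contra ne => /eqP ->.
rewrite (piv_Wp hn v vgWp) eq_sym (negbTE vgv) add0r.
rewrite (bigD1 (v * gen i)%g) /=; last by rewrite vgWp.
rewrite gg (piv_Wp hn v vWp) (piv_Wp hn v vgWp) eqxx eq_sym (negbTE vgv).
rewrite mulr0 if_same addr0 mulr1 big1 => [|w /andP[/andP[wWp wv] wvg]].
  by rewrite addr0 addrC; congr (_ + _); case: ifP => _; rewrite ?mulr0 // mulrC.
by apply: other => //; apply: contra wvg => /eqP ->; rewrite gg.
Qed.

Lemma same_letter (K : fieldType) (r x : K) : - r * x + r * x = 0.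
Proof. by ring. Qed.
Lemma shorter (K : fieldType) (r x y : K) : y + (r^-1 - r) * x + r * x = y + r^-1 * x.
Proof. by ring. Qed.

Lemma actCE i (m : vecN n) v : v \in Wp n -> actC i m v =
  if signs (v * gen i)%g == signs v then 0
  else m (v * gen i)%g + (if (len (v * gen i)%g < len v)%N then q^-1 else q) * m v.
Proof.
move=> vWp; rewrite /actC actSE //; case: ifP => _; first exact: same_letter.
by case: ifP => _; [exact: shorter | rewrite addr0].
Qed.

Lemma factor_cup (K : fieldType) (r a b : K) : r != 0 -> a + r * b = r * (b + r^-1 * a).
Proof. by move=> r0; field. Qed.

(** For [a = b] both sides vanish. Otherwise [v] and [v * gen i] carry the two labelings of the cap,
    and [a] tells which is longer, hence whether the weight is [q] or [q^-1]. *)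
Lemma actC_cup i x (m : vecN n) v u (a b : bool) t : v \in Wp n -> (0 < val i)%N ->
  (forall v, v \in Wp n -> m v = graph x v) -> (size u).+1 = i ->
  signs v = u ++ [:: a, b & t] ->
  actC i m v = cup q a b *
    (exec q (@closing F) [::] (signs x) (u ++ [:: false, true & t])
     + q^-1 * exec q (@closing F) [::] (signs x) (u ++ [:: true, false & t])).
Proof.
move=> vWp i0 mE su sv; have vW := Wp_W hn vWp.
have svg := signs_gen_pos hn vW i0 su sv.
have au : alpha v (val i).-1 = a.
  have <- : nth true (signs v) (val i).-1 = alpha v (val i).-1.
    by rewrite nth_mkseq // (leq_ltn_trans (leq_pred _)) ?ltn_ord.
  have -> : (val i).-1 = size u by rewrite -[val i]/(nat_of_ord i) -su.
  by rewrite sv nth_cat ltnn subnn.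
rewrite actCE //; case: eqP => [e|/eqP ne].
  move: e; rewrite svg sv => /eqP; rewrite eqseq_cat // eqxx /= => /and3P[/eqP -> _ _].
  by rewrite /cup; case: (a); rewrite mul0r.
have vgWp : (v * gen i)%g \in Wp n by apply: gen_increasing.
rewrite !mE // signs_gen_neq // neg_lo_signs // au (gtn_eqF i0) /graph svg sv /=.
rewrite svg sv eqseq_cat // eqxx /= in ne.
case: a b {sv svg au} ne => [] [] //=; rewrite ?eqxx // => _.
  by rewrite /cup /= expr0 mul1r.
by rewrite /cup /= expr1 -factor_cup ?q_neq0.
Qed.

Lemma actC_cup0 i x (m : vecN n) v (a b : bool) t : v \in Wp n -> val i = 0%N ->
  (forall v, v \in Wp n -> m v = graph x v) ->
  signs v = [:: a, b & t] ->
  actC i m v = cup0 q a b *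
    (exec q (@closing F) [::] (signs x) [:: true, true & t]
     + q^-1 * exec q (@closing F) [::] (signs x) [:: false, false & t]).
Proof.
move=> vWp i0 mE sv; have vW := Wp_W hn vWp.
have svg := signs_gen_zero hn vW i0 sv.
have au : alpha v 0 = a.
  have <- : nth true (signs v) 0 = alpha v 0 by rewrite nth_mkseq //; lia.
  by rewrite sv.
rewrite actCE //; case: eqP => [e|/eqP ne].
  by move: e; rewrite svg sv /cup0 => -[<- _]; case: (b); rewrite mul0r.
have vgWp : (v * gen i)%g \in Wp n by apply: gen_increasing.
rewrite !mE // signs_gen_neq // neg_lo_signs // i0 au /graph svg sv /=.
rewrite svg sv in ne.
case: a b {sv svg au} ne => [] [] //=; rewrite ?eqxx // => _.
  by rewrite /cup0 /= expr1 -factor_cup ?q_neq0.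
by rewrite /cup0 /= expr0 mul1r.
Qed.

Lemma actC_graph i x (m : vecN n) : x \in Wp n ->
  (forall v, v \in Wp n -> m v = graph x v) ->
  exists d : gT n -> F, (forall y, bar_rel (d y) (d y)) /\
  forall v, v \in Wp n -> actC i m v = \sum_(y in Wp n) d y * graph y v.
Proof.
move=> xWp mE; have xW := Wp_W hn xWp.
have sx w : size (signs w) = n by rewrite size_mkseq.
have bar_if (P : bool) c : bar_rel c c -> bar_rel (if P then c else 0) (if P then c else 0).
  by case: P => // _; exact: bar_rel0.
have out (o : TL_result (signs x)) : exists d : gT n -> F, (forall y, bar_rel (d y) (d y)) /\
   forall v, v \in Wp n -> TL_value q o (signs v) = \sum_(y in Wp n) d y * graph y v.
  have single z c : z \in Wp n -> bar_rel c c ->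
    (forall v, v \in Wp n -> TL_value q o (signs v) = c * graph z v) ->
    exists d : gT n -> F, (forall y, bar_rel (d y) (d y)) /\
    forall v, v \in Wp n -> TL_value q o (signs v) = \sum_(y in Wp n) d y * graph y v.
    move=> zWp cc H; exists (fun y => if y == z then c else 0); split=> [y|v vWp].
      exact: bar_if.
    rewrite H // (bigD1 z) //= eqxx big1 ?addr0 // => y /andP[_ /negbTE ->].
    by rewrite mul0r.
  case: o single => [||w' sw pw] single.
  - apply: (single x (q + q^-1)) => //.
    rewrite [X in bar_rel _ X]addrC; apply: bar_relD; [exact: bar_relq|exact: bar_relqV].
  - by apply: (single x 0) => // [|v _]; [exact: bar_rel0 | rewrite mul0r].
  (* Here the preserved parity makes the straightened sequence that of an element of [W^p]. *)
  - have [||z zWp zs] := @signs_surj n hn w'; first by rewrite sw sx.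
      by rewrite pw par_signs.
    by apply: (single z 1) => // [|v _]; [exact: bar_rel1 | rewrite mul1r /graph zs].
case: (posnP (val i)) => i0.
  have [|p [c [d [r [xs /size0nil p0]]]]] := @split_at _ (signs x) 0.
    by rewrite sx; lia.
  rewrite p0 /= in xs; have := run_TL0 q_neq0 c d r; rewrite -xs => -[o Ho].
  have [d' [bd Hd]] := out o; exists d'; split=> // v vWp; rewrite -Hd //.
  have [|u [a [b [t [vs /size0nil u0]]]]] := @split_at _ (signs v) 0.
    by rewrite sx; lia.
  rewrite u0 /= in vs; rewrite vs -Ho; last first.
    by have := sx v; have := sx x; rewrite vs xs /=; lia.
  exact: actC_cup0 vs.
have ii : ((val i).-1.+1 < n)%N by rewrite prednK // ltn_ord.
have [|p [c [d [r [xs sp]]]]] := @split_at _ (signs x) (val i).-1; first by rewrite sx.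
have := run_TL q_neq0 p c d r; rewrite -xs => -[o Ho].
have [d' [bd Hd]] := out o; exists d'; split=> // v vWp; rewrite -Hd //.
have [|u [a [b [t [vs su]]]]] := @split_at _ (signs v) (val i).-1; first by rewrite sx.
rewrite vs -Ho ?su //; last first.
  by have := sx v; have := sx x; rewrite vs xs !size_cat /=; lia.
by apply: actC_cup vs => //; rewrite su prednK.
Qed.

(* The graphs of all elements form a basis; [bar_pair m m'] says that [m'] is the image of [m] under the semilinear map fixing this basis. *)
Definition bar_pair (m m' : gT n -> F) : Prop :=
  exists a a' : gT n -> F, [/\ forall x, bar_rel (a x) (a' x),
    forall v, v \in Wp n -> m v = \sum_(x in Wp n) a x * graph x v &
    forall v, v \in Wp n -> m' v = \sum_(x in Wp n) a' x * graph x v].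

Lemma bar_pair_ext m1 m1' m2 m2' : {in Wp n, m1 =1 m2} -> {in Wp n, m1' =1 m2'} ->
  bar_pair m1 m1' -> bar_pair m2 m2'.
Proof.
move=> e e' [a [a' [r H H']]]; exists a, a'; split=> // v vWp.
  by rewrite -e ?H.
by rewrite -e' ?H'.
Qed.

Lemma bar_pair0 : bar_pair (fun=> 0) (fun=> 0).
Proof.
exists (fun=> 0), (fun=> 0); split=> [x|v _|v _]; first exact: bar_rel0.
  by rewrite big1 // => x _; rewrite mul0r.
by rewrite big1 // => x _; rewrite mul0r.
Qed.

Lemma sum_lincomb (K : comNzRingType) (c : K) (a b : gT n -> K) (g : gT n -> K) :
  \sum_(x in Wp n) a x * g x + c * (\sum_(x in Wp n) b x * g x)
  = \sum_(x in Wp n) (a x + c * b x) * g x.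
Proof.
by rewrite mulr_sumr -big_split; apply: eq_bigr => x _; rewrite mulrDl mulrA.
Qed.

Lemma bar_pairD c c' m1 m1' m2 m2' : bar_rel c c' ->
  bar_pair m1 m1' -> bar_pair m2 m2' ->
  bar_pair (fun v => m1 v + c * m2 v) (fun v => m1' v + c' * m2' v).
Proof.
move=> cc [a [a' [r H H']]] [b [b' [s L L']]].
exists (fun x => a x + c * b x), (fun x => a' x + c' * b' x).
split=> [x|v vWp|v vWp]; first by apply: bar_relD => //; apply: bar_relM.
  by rewrite H // L // sum_lincomb.
by rewrite H' // L' // sum_lincomb.
Qed.

Lemma bar_pair_sum (c c' : gT n -> F) (M M' : gT n -> gT n -> F) :
  (forall x, x \in Wp n -> bar_rel (c x) (c' x)) ->
  (forall x, x \in Wp n -> bar_pair (M x) (M' x)) ->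
  bar_pair (fun v => \sum_(x in Wp n) c x * M x v)
           (fun v => \sum_(x in Wp n) c' x * M' x v).
Proof.
move=> cc MM; pose S r (c : gT n -> F) (M : gT n -> gT n -> F) v :=
  \sum_(x <- r | x \in Wp n) c x * M x v.
suff: bar_pair (S (index_enum _) c M) (S (index_enum _) c' M') by [].
elim: (index_enum _) => [|x r IH].
  by apply: bar_pair_ext bar_pair0 => v _; rewrite /S big_nil.
case xWp: (x \in Wp n); last first.
  by apply: bar_pair_ext IH => v _; rewrite /S big_cons xWp.
apply: bar_pair_ext (bar_pairD (cc x xWp) IH (MM x xWp)) => v _;
  by rewrite /S big_cons xWp addrC.
Qed.

Lemma bar_pair_graph x : x \in Wp n -> bar_pair (graph x) (graph x).
Proof.
move=> xWp; have E v : graph x v = \sum_(y in Wp n) (y == x)%:R * graph y v.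
  rewrite (bigD1 x) //= eqxx mul1r big1 ?addr0 // => y /andP[_ /negbTE ->].
  by rewrite mul0r.
exists (fun y => (y == x)%:R), (fun y => (y == x)%:R); split=> // y.
by case: (y == x); [exact: bar_rel1 | exact: bar_rel0].
Qed.

Lemma actS_sum i (c : gT n -> F) (M : gT n -> vecN n) (m : vecN n) v :
  (forall v, v \in Wp n -> m v = \sum_(x in Wp n) c x * M x v) ->
  actS i m v = \sum_(x in Wp n) c x * actS i (M x) v.
Proof.
move=> mE; rewrite ffunE; under [RHS]eq_bigr => x _ do rewrite ffunE mulr_sumr.
rewrite exchange_big; apply: eq_bigr => w wWp; rewrite mE // mulr_suml.
by apply: eq_bigr => x _; rewrite mulrA.
Qed.

Lemma actSinvE (K : comNzRingType) (r s a b : K) : a + r * b - s * b = a + (r - s) * b.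
Proof. by ring. Qed.

Lemma actSinv_sum i (c : gT n -> F) (M : gT n -> vecN n) (m : vecN n) v :
  v \in Wp n ->
  (forall v, v \in Wp n -> m v = \sum_(x in Wp n) c x * M x v) ->
  actSinv i m v = \sum_(x in Wp n) c x * actSinv i (M x) v.
Proof.
move=> vWp mE; rewrite ffunE (actS_sum i v mE) mE // mulr_sumr -big_split.
by apply: eq_bigr => x _; rewrite [in RHS]ffunE mulrDr [in RHS]mulrCA.
Qed.

(* Both sides are [C_s] minus a multiple of the identity, and [C_s] maps graphs to invariant combinations of graphs. *)
Lemma bar_pair_act i (m m' : vecN n) : bar_pair m m' ->
  bar_pair (actS i m) (actSinv i m').
Proof.
case=> a [a' [r H H']].
pose G x : vecN n := [ffun v => graph x v].
have mE v : v \in Wp n -> m v = \sum_(x in Wp n) a x * G x v.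
  by move=> vWp; rewrite H //; apply: eq_bigr => x _; rewrite ffunE.
have mE' v : v \in Wp n -> m' v = \sum_(x in Wp n) a' x * G x v.
  by move=> vWp; rewrite H' //; apply: eq_bigr => x _; rewrite ffunE.
have key x : x \in Wp n -> bar_pair (actS i (G x)) (actSinv i (G x)).
  move=> xWp; have [v _|d [dd Hd]] := @actC_graph i x (G x) xWp; first by rewrite ffunE.
  have C : bar_pair (actC i (G x)) (actC i (G x)) by exists d, d.
  apply: bar_pair_ext (bar_pairD (bar_relN bar_relq) C (bar_pair_graph xWp)) => v _.
    by rewrite /actC [G x v]ffunE mulNr addrK.
  by rewrite /actC [actSinv _ _ _]ffunE [G x v]ffunE mulNr actSinvE.
apply: bar_pair_ext (bar_pair_sum (fun x _ => r x) key) => v vWp.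
  by rewrite (actS_sum i v mE).
by rewrite (actSinv_sum i vWp mE').
Qed.

Lemma lexval_bound s : (lexval s < 2 ^ size s)%N.
Proof. by elim: s => //= c s IH; rewrite expnS; case: c => /=; lia. Qed.

Lemma graph_diag x : graph x x = 1.
Proof. exact: run_diag. Qed.

Lemma graph_lt x v : x \in Wp n -> v \in Wp n -> v != x ->
  graph x v = 0 \/ (lexval (signs v) < lexval (signs x))%N.
Proof.
move=> xWp vWp ne; have [|nz] := eqVneq (graph x v) 0; first by left.
have sz : size (signs v) = size (signs x) by rewrite !size_mkseq.
have [e|lt] := run_lexval q_neq0 sz nz; last by right.
by case/eqP: ne; apply: (Wp_inj hn vWp xWp).
Qed.

Lemma graph_power x v : x \in Wp n -> v \in Wp n -> v != x -> in_qZq (graph x v).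
Proof.
move=> xWp vWp ne; have [||[[|k] [e H]]] := @run_power F q [::] (signs x) (signs v).
- by rewrite !size_mkseq.
- by move=> e; rewrite /graph e; exact: in_qZq0.
- have [_ es] := H erefl.
  by case/eqP: ne; apply: (Wp_inj hn vWp xWp).
- by rewrite /graph e; exact: in_qZqXn.
Qed.

(** For [y] other than [x], [graph y x] vanishes unless [y] has larger [lexval], and there [b]
    vanishes. *)
Lemma top_coef x (b : gT n -> F) : x \in Wp n ->
  (forall y, y \in Wp n -> (lexval (signs x) < lexval (signs y))%N -> b y = 0) ->
  \sum_(y in Wp n) b y * graph y x = b x.
Proof.
move=> xWp H; rewrite (bigD1 x) //= graph_diag mulr1 big1 ?addr0 // => y /andP[yWp yx].
have [|->|lt] := @graph_lt y x yWp xWp; first by rewrite eq_sym.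
  by rewrite mulr0.
by rewrite H // mul0r.
Qed.

Lemma top_ind (P : gT n -> Prop) :
  (forall x, x \in Wp n -> (forall y, y \in Wp n ->
     (lexval (signs x) < lexval (signs y))%N -> P y) -> P x) ->
  forall x, x \in Wp n -> P x.
Proof.
move=> step x; have [d] := ubnP (2 ^ n - lexval (signs x))%N.
elim: d x => // d IH x xd xWp; apply: step => // y yWp lt; apply: IH => //.
by have := lexval_bound (signs y); rewrite size_mkseq; lia.
Qed.

Lemma graph_free (a b : gT n -> F) :
  (forall v, v \in Wp n ->
     \sum_(x in Wp n) a x * graph x v = \sum_(x in Wp n) b x * graph x v) ->
  {in Wp n, a =1 b}.
Proof.
move=> H; apply: top_ind => x xWp IH; apply/eqP; rewrite -subr_eq0; apply/eqP.
rewrite -(@top_coef x (fun y => a y - b y)) // => [|y yWp lt]; last first.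
  by rewrite IH // subrr.
under eq_bigr => y _ do rewrite mulrBl.
by rewrite sumrB H // subrr.
Qed.

(** The sequence of the identity is all [+], of [lexval] 0, so its diagram vector has no lower
    term. *)
Lemma bar_pair_Nb1 : bar_pair (Nb 1%g) (Nb 1%g).
Proof.
have W1 := Wp1 hn; apply: bar_pair_ext (bar_pair_graph W1) => v vWp; rewrite ffunE;
  have [->|ne] := eqVneq v 1%g; rewrite ?graph_diag //;
  have [//|] := graph_lt W1 vWp ne;
  by rewrite signs1 (_ : lexval (nseq n true) = 0%N) //; elim: (n) => //= k ->.
Qed.

Lemma bar_pair_word (s : seq 'I_n) : word_prod s \in Wp n ->
  len (word_prod s) = size s ->
  bar_pair (Nb (word_prod s)) (foldl (fun (m : vecN n) i => actSinv i m) (Nb 1%g) s).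
Proof.
elim/last_ind: s => [|s i IH] sWp ls.
  by rewrite /word_prod big_nil; exact: bar_pair_Nb1.
rewrite size_rcons in ls; have [uWp lu lt] := Wp_prefix hn sWp ls.
rewrite foldl_rcons; apply: bar_pair_ext (bar_pair_act i (IH uWp lu)) => // v vWp.
(* The length grows along a reduced word, so [H_s] sends the basis vector of the prefix to that of
   the longer prefix with no correction term. *)
rewrite word_rcons in sWp *; rewrite ffunE (bigD1 (word_prod s)) //=.
rewrite ltnNge (ltnW lt) /= addr0 big1 => [|w /andP[_ wu]].
  by rewrite (piv_Wp hn v sWp) !ffunE eqxx mul1r ?addr0.
by rewrite ffunE (negbTE wu) mul0r.
Qed.

Lemma bar_pair_Nb w : w \in Wp n -> bar_pair (Nb w) (barNb w).
Proof.
move=> wWp; have [rE rs] := rw_word hn (Wp_W hn wWp).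
by have := bar_pair_word (s := rw w); rewrite rE rs => /(_ wWp erefl).
Qed.

Lemma bar_pair_barN (r : gT n -> LR) : bar_pair (fun v => valL (r v)) (barN r).
Proof.
have rr x : x \in Wp n -> bar_rel (valL (r x)) (barL (r x)) by exists (r x).
apply: bar_pair_ext (bar_pair_sum rr bar_pair_Nb) => v vWp; last by rewrite ffunE.
rewrite (bigD1 v) //= ffunE eqxx mulr1 big1 ?addr0 // => x /andP[_ xv].
by rewrite ffunE eq_sym (negbTE xv) mulr0.
Qed.

Lemma KLfam_graph (b : gT n -> gT n -> LR) : KLfam b <->
  (forall w v, w \in Wp n -> v \in Wp n -> valL (b w v) = graph w v).
Proof.
split=> [KL w v wWp vWp|H w wWp].
  have [inv d1 off] := KL w wWp.
  have [a [a' [r Ha Ha']]] := bar_pair_barN (b w).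
  have aa : {in Wp n, a =1 a'}.
    by apply: graph_free => x xWp; rewrite -Ha // -Ha' // inv.
  (* Once this holds above [x], the left side is the difference of the entries of [b w] and
     [graph w] at [x]. For [x] other than [w] it is bar-fixed and lies in [q Z[q]], hence is
     zero. *)
  have ad : forall x, x \in Wp n -> a x - (x == w)%:R = 0.
    apply: top_ind => x xWp IH.
    have := top_coef (b := fun y => a y - (y == w)%:R) xWp IH.
    under eq_bigr => y _ do rewrite mulrBl.
    rewrite sumrB -Ha // (bigD1 w) //= eqxx mul1r big1 => [|y /andP[_ /negbTE ->]];
      last by rewrite mul0r.
    rewrite addr0; have [->|ne] := eqVneq x w.
      by rewrite d1 graph_diag => <-; rewrite subrr.
    rewrite subr0 => e; apply: bar_fixed_qZq; last by rewrite {2}(aa x xWp); exact: r.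
    by rewrite -e; apply: in_qZqB; [exact: off | exact: graph_power].
  rewrite Ha // (bigD1 w) //= big1 => [|x /andP[xWp xw]].
    by have /eqP := ad w wWp; rewrite eqxx subr_eq0 => /eqP ->; rewrite mul1r addr0.
  by have := ad x xWp; rewrite (negbTE xw) subr0 => ->; rewrite mul0r.
split=> [v vWp||v vWp vw]; rewrite ?H ?graph_diag //; last exact: graph_power.
have [a [a' [r Ha Ha']]] := bar_pair_barN (b w).
have [d [d' [s Hd Hd']]] := bar_pair_graph wWp.
have ad : {in Wp n, a =1 d}.
  by apply: graph_free => x xWp; rewrite -Ha // -Hd // H.
rewrite Ha' // Hd' //; apply: eq_bigr => x xWp; congr (_ * _).
by apply: (bar_rel_fun (r x)); rewrite ad //; exact: s.
Qed.

End Hecke.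

Theorem theorem2p10 (n : nat) (hn : (4 <= n)%N)
    (b : gT n -> gT n -> LR) :
  KLfam b <->
  (forall w v, w \in Wp n -> v \in Wp n ->
     valL (b w v) = if oriented v w then q ^+ (cl v w %/ 2) else 0).
Proof.
rewrite KLfam_graph //; split=> H w v wWp vWp.
  by rewrite H // graph_run.
by rewrite H // graph_run.
Qed.
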